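(* Let $M$ be a positive integer. Each operator $\mathcal{A}\in\mathscr{A}_{2,M}$ has a representation of the form $$\mathcal{A}\mathbf{u}=\mathbf{A}_0\mathbf{u}+\mathbf{A}_1\langle \mathbf{B}_1\mathbf{u}\rangle_1+\mathbf{A}_2\langle \mathbf{B}_2\mathbf{u}\rangle_2+\mathcal{K}\mathbf{u},\qquad \mathbf{u}\in L^2_{2,M},\qquad ( * )$$ where $\mathcal{K}\in\mathscr{K}_{2,M}$ and $\mathbf{A}_0,\mathbf{A}_1,\mathbf{A}_2,\mathbf{B}_1,\mathbf{B}_2$ are continuous (complex) matrix-valued functions on $[0,1]^2$ of sizes $$\dim(\mathbf{A}_0)=M\times M,\qquad \dim(\mathbf{B}_j)=M_j\times M,\qquad \dim(\mathbf{A}_j)=M\times M_j,\qquad j=1,2,$$ with some positive integers $M_1,M_2$. Moreover, the set of all operators of the form $( * )$ coincides with $\mathscr{A}_{2,M}$.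
   Context: Let $M$ be a positive integer and $L^2_{2,M}:=L^2([0,1]^2,\mathbb{C}^M)$. Points of $[0,1]^2$ are written $\mathbf{k}=(k_1,k_2)$. For a matrix- or vector-valued function of $\mathbf{k}\in[0,1]^2$ put $\langle\cdot\rangle_i:=\int_0^1\cdot\,dk_i$ for $i=1,2$; thus $\langle\cdot\rangle_1$ yields a function of $k_2$ only and $\langle\cdot\rangle_2$ yields a function of $k_1$ only, and these are again regarded as functions on $[0,1]^2$. Let $\mathscr{B}_{2,M}$ denote the algebra of all bounded linear operators on $L^2_{2,M}$, and $\mathscr{K}_{2,M}$ the set of all compact operators on $L^2_{2,M}$. The algebra of 2D periodic operators with local and perpendicular defects, $$\mathscr{A}_{2,M}=\mathrm{Alg}\{\mathbf{A}\,\cdot,\ \langle\cdot\rangle_1,\ \langle\cdot\rangle_2,\ \mathcal{K}\},$$ is the minimal (non-closed, i.e. no topological closure is taken) subalgebra of $\mathscr{B}_{2,M}$ which contains all operators of multiplication $\mathbf{u}\mapsto\mathbf{A}\mathbf{u}$ by continuous $M\times M$ matrix-valued functions $\mathbf{A}$ on $[0,1]^2$, the integral projectors $\langle\cdot\rangle_1$ and $\langle\cdot\rangle_2$, and all compact operators $\mathcal{K}\in\mathscr{K}_{2,M}$. *)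

(* Defs.v *)
From HB Require Import structures.
From mathcomp Require Import all_boot all_order all_algebra complex.
From mathcomp Require Import all_classical all_reals all_analysis.
From mathcomp Require Import measurable_realfun ring lra.
Set Implicit Arguments.
Unset Strict Implicit.
Unset Printing Implicit Defensive.
Import Order.TTheory GRing.Theory Num.Theory.
Import numFieldNormedType.Exports.
Local Open Scope classical_set_scope.
Local Open Scope ring_scope.
Local Open Scope complex_scope.
Local Open Scope quotient_scope.

(* The usual topology of the complex numbers R[i], which real-closed leaves
   without one; the norm is the modulus. *)
HB.instance Definition _ (R : realType) := NormedModule.copy R[i] (R[i]^o).

Definition unit_itv (R : realType) : set R := `[0, 1].
Definition unit_square (R : realType) : set (R * R) :=
  @unit_itv R `*` @unit_itv R.
Arguments unit_itv {R}.
Arguments unit_square {R}.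

(* Two-dimensional Lebesgue measure on R * R. *)
Notation leb2 R := (@lebesgue_measure R \x @lebesgue_measure R)%E.

Notation measurable_plane R := (measurableTypeR R * measurableTypeR R)%type.

Section L2.
Context (R : realType) (m : nat).
Implicit Types (v w : 'cV[R[i]]_m) (f g : R * R -> 'cV[R[i]]_m).

(* The squared Euclidean norm on C^m (the norm that the library puts on
   matrices is the maximum norm). *)
Definition sqnorm v : R :=
  \sum_(j < m) (complex.Re (v j 0) ^+ 2 + complex.Im (v j 0) ^+ 2).

Definition measurable_vec f : Prop := forall j : 'I_m,
  measurable_fun (unit_square : set (measurable_plane R))
    (fun k => complex.Re (f k j 0)) /\
  measurable_fun (unit_square : set (measurable_plane R))
    (fun k => complex.Im (f k j 0)).

Definition square_integrable : {pred R * R -> 'cV[R[i]]_m} := mem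
  [set f | measurable_vec f /\
    (leb2 R).-integrable unit_square (fun k => (sqnorm (f k))%:E)].

Lemma measurable_unit_itv : measurable (@unit_itv R : set (measurableTypeR R)).
Proof. exact: measurable_itv. Qed.

Lemma measurable_unit_square :
  measurable (@unit_square R : set (measurable_plane R)).
Proof. by apply: measurableX; exact: measurable_unit_itv. Qed.

Lemma sqnorm_ge0 v : 0 <= sqnorm v.
Proof. by apply: sumr_ge0 => j _; rewrite addr_ge0 ?sqr_ge0. Qed.

Lemma sqnorm0 : sqnorm 0 = 0.
Proof. by rewrite /sqnorm big1// => j _; rewrite mxE/= expr0n addr0. Qed.

Lemma sqnorm_eq0 v : sqnorm v = 0 -> v = 0.
Proof.
move=> /eqP; rewrite psumr_eq0; last by move=> j _; rewrite addr_ge0 ?sqr_ge0.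
move=> /allP h; apply/colP => j; rewrite mxE.
have := h j (mem_index_enum j); rewrite /= paddr_eq0 ?sqr_ge0// !sqrf_eq0.
by case: (v j 0) => a b /= /andP[/eqP -> /eqP ->].
Qed.

Lemma sqnormZ (a : R[i]) v :
  sqnorm (a *: v) = (complex.Re a ^+ 2 + complex.Im a ^+ 2) * sqnorm v.
Proof.
rewrite /sqnorm mulr_sumr; apply: eq_bigr => j _; rewrite mxE.
by case: a (v j 0) => a b [c d] /=; ring.
Qed.

Lemma sqnormD (t : R) v w : 0 < t ->
  sqnorm (v + w) <= (1 + t) * sqnorm v + (1 + t^-1) * sqnorm w.
Proof.
move=> t0; rewrite /sqnorm !mulr_sumr -big_split/=; apply: ler_sum => j _.
rewrite mxE; case: (v j 0) (w j 0) => [a b] [c d] /=.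
have H (x y : R) : (x + y) ^+ 2 <= (1 + t) * x ^+ 2 + (1 + t^-1) * y ^+ 2.
  rewrite -subr_ge0.
  rewrite (_ : _ - _ = t^-1 * (t * x - y) ^+ 2); last by field; rewrite gt_eqF.
  by rewrite mulr_ge0 ?sqr_ge0// invr_ge0 ltW.
by have := H a c; have := H b d; lra.
Qed.

Lemma measurable_sqnorm f : measurable_vec f ->
  measurable_fun (unit_square : set (measurable_plane R))
    (fun k => sqnorm (f k)).
Proof.
move=> mf; apply: measurable_sum => j.
by have [? ?] := mf j; apply: measurable_funD; exact: measurable_funX.
Qed.

Lemma measurable_vec0 : measurable_vec 0.
Proof.
by move=> j; split; under eq_fun do rewrite mxE/=; exact: measurable_cst.
Qed.

Lemma measurable_vecD f g :
  measurable_vec f -> measurable_vec g -> measurable_vec (f + g).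
Proof.
move=> mf mg j; have [mfr mfi] := mf j; have [mgr mgi] := mg j; split.
- rewrite (_ : (fun k => _) =
    (fun k => complex.Re (f k j 0)) \+ (fun k => complex.Re (g k j 0))).
    exact: measurable_funD.
  by apply/funext => k /=; rewrite mxE; case: (f k j 0) (g k j 0) => ? ? [].
- rewrite (_ : (fun k => _) =
    (fun k => complex.Im (f k j 0)) \+ (fun k => complex.Im (g k j 0))).
    exact: measurable_funD.
  by apply/funext => k /=; rewrite mxE; case: (f k j 0) (g k j 0) => ? ? [].
Qed.

Lemma measurable_vecZ (a : R[i]) f : measurable_vec f -> measurable_vec (a *: f).
Proof.
move=> mf j; have [mfr mfi] := mf j; case: a => a b; split.
- rewrite (_ : (fun k => _) = (fun k =>
    a * complex.Re (f k j 0) - b * complex.Im (f k j 0))).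
    by apply: measurable_funB; exact: measurable_funM.
  by apply/funext => k /=; rewrite mxE; case: (f k j 0).
- rewrite (_ : (fun k => _) = (fun k =>
    a * complex.Im (f k j 0) + b * complex.Re (f k j 0))).
    by apply: measurable_funD; exact: measurable_funM.
  by apply/funext => k /=; rewrite mxE; case: (f k j 0).
Qed.

Lemma square_integrableP f : reflect (measurable_vec f /\
    (leb2 R).-integrable unit_square (fun k => (sqnorm (f k))%:E))
  (f \in square_integrable).
Proof. by apply: (iffP idP) => [|h]; rewrite ?inE//; apply/mem_set. Qed.

Lemma square_integrable_submod : submod_closed square_integrable.
Proof.
have mS := measurable_unit_square.
split.
  apply/square_integrableP; split; first exact: measurable_vec0.
  under eq_fun do rewrite sqnorm0.
  exact: integrable0.
have Z a f : f \in square_integrable -> a *: f \in square_integrable.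
  move=> /square_integrableP[mf intf]; apply/square_integrableP; split.
    exact: measurable_vecZ.
  under eq_fun do rewrite sqnormZ EFinM.
  exact: integrableZl.
move=> a f g fS gS; have /square_integrableP[mf intf] := Z a f fS.
have /square_integrableP[mg intg] := gS.
have mD : measurable_vec (a *: f + g) by exact: measurable_vecD.
apply/square_integrableP; split => //.
apply: (@le_integrable _ _ _ (leb2 R) _ mS _ (fun k =>
  ((2%:E * (sqnorm ((a *: f) k))%:E) + 2%:E * (sqnorm (g k))%:E)%E)) => //.
- by have /measurable_EFinP := measurable_sqnorm mD.
- move=> k _; rewrite -!EFinM -EFinD !abse_EFin lee_fin.
  rewrite !ger0_norm ?addr_ge0 ?mulr_ge0 ?sqnorm_ge0//.
  have := @sqnormD 1 ((a *: f) k) (g k) ltr01; rewrite invr1.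
  by rewrite (_ : 1 + 1 = 2).
- by apply: integrableD => //; apply: integrableZl.
Qed.

HB.instance Definition _ :=
  GRing.isSubmodClosed.Build R[i] (R * R -> 'cV[R[i]]_m) square_integrable
    square_integrable_submod.

Record L2fun : Type :=
  MkL2fun { L2fun_val :> R * R -> 'cV[R[i]]_m ;
            _ : L2fun_val \in square_integrable }.

HB.instance Definition _ := [isSub for L2fun_val].
HB.instance Definition _ := [Choice of L2fun by <:].
HB.instance Definition _ := [SubChoice_isSubLmodule of L2fun by <:].

Definition L2_eq (f g : L2fun) : bool :=
  `[< (f : R * R -> _) = g %[ae (leb2 R) in unit_square] >].

Lemma L2_eq_refl : reflexive L2_eq.
Proof. by move=> f; apply/asboolP; exact: ae_eq_refl. Qed.

Lemma L2_eq_sym : symmetric L2_eq.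
Proof.
by move=> f g; apply/idP/idP => /asboolP h; apply/asboolP/ae_eq_sym.
Qed.

Lemma L2_eq_trans : transitive L2_eq.
Proof.
by move=> f g h /asboolP gf /asboolP fh; apply/asboolP/(ae_eq_trans gf fh).
Qed.

Canonical L2_eq_equiv := EquivRel L2_eq L2_eq_refl L2_eq_sym L2_eq_trans.

Definition L2 : Type := {eq_quot L2_eq}.
HB.instance Definition _ := Choice.on L2.
HB.instance Definition _ := EqQuotient.on L2.

Definition L2_fun (u : L2) : R * R -> 'cV[R[i]]_m := repr u.
Coercion L2_fun : L2 >-> Funclass.

Lemma L2_eqP (f g : L2fun) :
  (\pi_L2 f = \pi_L2 g) <->
  (f : R * R -> _) = g %[ae (leb2 R) in unit_square].
Proof.
split=> [/eqP|h]; last apply/eqP; first by rewrite eqmodE => /asboolP.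
by rewrite eqmodE; apply/asboolP.
Qed.

Lemma repr_piE (f : L2fun) :
  (repr (\pi_L2 f) : R * R -> _) = f %[ae (leb2 R) in unit_square].
Proof. by apply/L2_eqP; rewrite reprK. Qed.

Lemma L2P (u : L2) : exists f : L2fun, u = \pi_L2 f.
Proof. by exists (repr u); rewrite reprK. Qed.

Definition L2_zero : L2 := \pi_L2 0.
Definition L2_opp (u : L2) : L2 := \pi_L2 (- repr u).
Definition L2_add (u v : L2) : L2 := \pi_L2 (repr u + repr v).
Definition L2_scale (a : R[i]) (u : L2) : L2 := \pi_L2 (a *: repr u).

Lemma pi_opp (f : L2fun) : L2_opp (\pi_L2 f) = \pi_L2 (- f).
Proof. exact/L2_eqP/(ae_eq_comp -%R)/repr_piE. Qed.

Lemma pi_add (f g : L2fun) : L2_add (\pi_L2 f) (\pi_L2 g) = \pi_L2 (f + g).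
Proof.
apply/L2_eqP.
apply: (ae_eq_trans (ae_eq_comp2 (fun (k : measurable_plane R)
  (y : 'cV[R[i]]_m) => repr (\pi_L2 f) k + y) (repr_piE g))).
exact: (ae_eq_comp2 (fun (k : measurable_plane R) (y : 'cV[R[i]]_m) =>
  y + g k) (repr_piE f)).
Qed.

Lemma pi_scale a (f : L2fun) : L2_scale a (\pi_L2 f) = \pi_L2 (a *: f).
Proof. exact/L2_eqP/(ae_eq_comp ( *:%R a))/repr_piE. Qed.

Lemma L2_addA : associative L2_add.
Proof.
move=> u v w; have [f ->] := L2P u; have [g ->] := L2P v.
have [h ->] := L2P w.
by rewrite !pi_add addrA. Qed.

Lemma L2_addC : commutative L2_add.
Proof.
move=> u v; have [f ->] := L2P u; have [g ->] := L2P v.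
by rewrite !pi_add addrC.
Qed.

Lemma L2_add0 : left_id L2_zero L2_add.
Proof. by move=> u; have [f ->] := L2P u; rewrite pi_add add0r. Qed.

Lemma L2_addN : left_inverse L2_zero L2_opp L2_add.
Proof. by move=> u; have [f ->] := L2P u; rewrite pi_opp pi_add addNr. Qed.

HB.instance Definition _ :=
  GRing.isZmodule.Build L2 L2_addA L2_addC L2_add0 L2_addN.

Lemma pi_addE (f g : L2fun) : \pi_L2 (f + g) = \pi_L2 f + \pi_L2 g.
Proof. by rewrite -pi_add. Qed.

Lemma L2_scaleA a b u : L2_scale a (L2_scale b u) = L2_scale (a * b) u.
Proof. by have [f ->] := L2P u; rewrite !pi_scale scalerA. Qed.

Lemma L2_scale1 : left_id 1 L2_scale.
Proof. by move=> u; have [f ->] := L2P u; rewrite pi_scale scale1r. Qed.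

Lemma L2_scaleDr : right_distributive L2_scale +%R.
Proof.
move=> a u v; have [f ->] := L2P u; have [g ->] := L2P v.
by rewrite -pi_addE !pi_scale -pi_addE scalerDr.
Qed.

Lemma L2_scaleDl u : {morph L2_scale^~ u : a b / a + b}.
Proof.
by move=> a b /=; have [f ->] := L2P u; rewrite !pi_scale scalerDl pi_addE.
Qed.

HB.instance Definition _ := GRing.Zmodule_isLmodule.Build R[i] L2
  L2_scaleA L2_scale1 L2_scaleDr L2_scaleDl.

Definition L2_norm (f : R * R -> 'cV[R[i]]_m) : R :=
  Num.sqrt (\int[leb2 R]_(k in unit_square) sqnorm (f k)).

Lemma L2_fun_integrable (f : L2fun) :
  (leb2 R).-integrable unit_square (fun k => (sqnorm (f k))%:E).
Proof. by case: f => f /= /square_integrableP[]. Qed.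

Lemma L2_fun_measurable (f : L2fun) : measurable_vec f.
Proof. by case: f => f /= /square_integrableP[]. Qed.

Lemma measurable_sqnormE (f : L2fun) :
  measurable_fun (unit_square : set (measurable_plane R))
    (fun k => (sqnorm (f k))%:E).
Proof.
by have /measurable_EFinP := measurable_sqnorm (L2_fun_measurable f).
Qed.

Lemma sqint_ge0 f : 0 <= \int[leb2 R]_(k in unit_square) sqnorm (f k).
Proof. by apply: Rintegral_ge0 => k _; exact: sqnorm_ge0. Qed.

Lemma L2_norm_pi (f : L2fun) : L2_norm (repr (\pi_L2 f)) = L2_norm f.
Proof.
rewrite /L2_norm /Rintegral; congr (Num.sqrt (fine _)).
apply: ge0_ae_eq_integral.
- exact: measurable_unit_square.
- exact: measurable_sqnormE.
- exact: measurable_sqnormE.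
- by move=> k _; rewrite lee_fin sqnorm_ge0.
- by move=> k _; rewrite lee_fin sqnorm_ge0.
- exact: (ae_eq_comp (fun v => (sqnorm v)%:E) (repr_piE f)).
Qed.

Lemma L2_norm_eq0 (u : L2) : (L2_norm u)%:C = 0 -> u = 0.
Proof.
rewrite -[u]reprK => -[]; rewrite [L2_norm _]L2_norm_pi => /eqP.
rewrite sqrtr_eq0 => u0; apply/L2_eqP.
have {}u0 : \int[leb2 R]_(k in unit_square) sqnorm (repr u k) = 0.
  by apply/eqP; rewrite eq_le u0 sqint_ge0.
have mS := measurable_unit_square.
have : (\int[leb2 R]_(k in unit_square) `|(sqnorm (repr u k))%:E| = 0)%E.
  under eq_integral do rewrite abse_EFin ger0_norm ?sqnorm_ge0//.
  rewrite -(@fineK _ (integral _ _ _)); first by rewrite [fine _]u0.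
  exact: (integrable_fin_num mS (L2_fun_integrable (repr u))).
move/(ae_eq_integral_abs _ mS (measurable_sqnormE _)).1.
case=> N [mN N0 sN]; exists N; split => //.
apply: subset_trans sN => k /= h h'; apply: h => Dk.
by apply: sqnorm_eq0; have := h' Dk; case.
Qed.

Lemma L2_normZ (a : R[i]) (u : L2) :
  (L2_norm (a *: u : L2))%:C = `|a| * (L2_norm u)%:C.
Proof.
have [f ->] := L2P u.
rewrite [a *: _]pi_scale ![L2_norm (L2_fun _)]L2_norm_pi normc_def -rmorphM.
congr (_%:C); rewrite -sqrtrM ?addr_ge0 ?sqr_ge0//; congr Num.sqrt.
rewrite -RintegralZl; [|exact: measurable_unit_square
                       |exact: L2_fun_integrable].
by apply: eq_Rintegral => k _; rewrite -sqnormZ.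
Qed.

Lemma sqint_addD (f g : L2fun) (t : R) : 0 < t ->
  \int[leb2 R]_(k in unit_square) sqnorm ((f + g) k) <=
  (1 + t) * \int[leb2 R]_(k in unit_square) sqnorm (f k) +
  (1 + t^-1) * \int[leb2 R]_(k in unit_square) sqnorm (g k).
Proof.
move=> t0; have mS := measurable_unit_square.
have If := L2_fun_integrable f; have Ig := L2_fun_integrable g.
have IZ (c : R) (h : L2fun) : (leb2 R).-integrable unit_square
    (EFin \o (fun k => c * sqnorm (h k))).
  exact: (integrableZl mS c (L2_fun_integrable h)).
rewrite -!RintegralZl// -RintegralD//; try exact: IZ.
apply: le_Rintegral => //.
- exact: L2_fun_integrable.
- exact: (integrableD mS (IZ _ f) (IZ _ g)).
- by move=> k _; exact: sqnormD.
Qed.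

Lemma L2_normD (u v : L2) :
  (L2_norm (u + v : L2))%:C <= (L2_norm u)%:C + (L2_norm v)%:C.
Proof.
have [->|u0] := eqVneq u 0.
  by rewrite add0r lerDr lecR sqrtr_ge0.
have [->|v0] := eqVneq v 0.
  by rewrite addr0 lerDl lecR sqrtr_ge0.
have N0 (w : L2) : w != 0 -> 0 < L2_norm w.
  move=> w0; rewrite lt_neqAle sqrtr_ge0 andbT eq_sym.
  by apply: contra w0 => /eqP h; apply/eqP/L2_norm_eq0; rewrite h.
rewrite -rmorphD lecR; move: (N0 _ u0) (N0 _ v0) => {N0 u0 v0}.
have [f ->] := L2P u; have [g ->] := L2P v.
rewrite [_ + _ : L2]pi_add ![L2_norm (L2_fun _)]L2_norm_pi => f0 g0.
rewrite -(ler_pXn2r (n := 2))// ?nnegrE ?addr_ge0 ?sqrtr_ge0//.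
have t0 : 0 < L2_norm g / L2_norm f by rewrite divr_gt0.
have := sqint_addD f g t0.
rewrite -[X in X <= _]sqr_sqrtr ?sqint_ge0//.
rewrite -[X in _ <= _ * X + _]sqr_sqrtr ?sqint_ge0//.
rewrite -[X in _ <= _ + _ * X]sqr_sqrtr ?sqint_ge0//.
rewrite -!/(L2_norm _) => /le_trans; apply.
rewrite le_eqVlt; apply/orP; left; apply/eqP.
by field; rewrite !gt_eqF.
Qed.

HB.instance Definition _ := Lmodule_isNormed.Build R[i] L2
  L2_normD L2_normZ L2_norm_eq0.
End L2.

Arguments square_integrable {R m}.

Section Averages.
Context (R : realType) (m : nat).

Definition cintegral (g : R -> R[i]) : R[i] :=
  (\int[@lebesgue_measure R]_(t in unit_itv) complex.Re (g t)) +i*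
  (\int[@lebesgue_measure R]_(t in unit_itv) complex.Im (g t)).

Definition avg1 (f : R * R -> 'cV[R[i]]_m) : R * R -> 'cV[R[i]]_m :=
  fun k => \col_j cintegral (fun t => f (t, k.2) j 0).

Definition avg2 (f : R * R -> 'cV[R[i]]_m) : R * R -> 'cV[R[i]]_m :=
  fun k => \col_j cintegral (fun t => f (k.1, t) j 0).
End Averages.

Definition continuous_mx (R : realType) (p q : nat)
    (A : R * R -> 'M[R[i]]_(p, q)) : Prop :=
  {within unit_square, continuous A}.

Section Operators.
Context (R : realType) (M : nat).
Implicit Types (T K : L2 R M -> L2 R M) (S : set (L2 R M -> L2 R M)).

Definition bounded_op : set (L2 R M -> L2 R M) :=
  [set T | linear T /\ exists C : R, forall u, `|T u| <= C%:C * `|u|].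

Definition compact_op : set (L2 R M -> L2 R M) :=
  [set T | linear T /\ precompact (T @` [set u | `|u| <= 1])].

(* T u is the class of the function F u.  The coercion from L2 R M to functions
   picks a representative; the F used below respect almost everywhere equality,
   so the choice does not matter. *)
Definition acts_as T (F : L2 R M -> R * R -> 'cV[R[i]]_M) : Prop :=
  forall u : L2 R M,
    (T u : R * R -> 'cV[R[i]]_M) = F u %[ae (leb2 R) in unit_square].

Lemma acts_as_unique T1 T2 F : acts_as T1 F -> acts_as T2 F -> T1 = T2.
Proof.
move=> h1 h2; apply/funext => u; rewrite -[T1 u]reprK -[T2 u]reprK.
exact/L2_eqP/(ae_eq_trans (h1 u))/ae_eq_sym/h2.
Qed.

Lemma acts_as_exists (F : L2 R M -> R * R -> 'cV[R[i]]_M) :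
  (forall u, F u \in square_integrable) -> exists T, acts_as T F.
Proof.
move=> hF; exists (fun u => \pi_(L2 R M) (MkL2fun (hF u))) => u.
exact: repr_piE.
Qed.

Definition subalgebra S : Prop :=
  [/\ S `<=` bounded_op,
      S (fun=> 0),
      forall T1 T2, S T1 -> S T2 -> S (fun u => T1 u + T2 u),
      forall (a : R[i]) T, S T -> S (fun u => a *: T u)
    & forall T1 T2, S T1 -> S T2 -> S (T1 \o T2)].

Definition multiplication_op : set (L2 R M -> L2 R M) :=
  [set T | exists A : R * R -> 'M[R[i]]_M,
     continuous_mx A /\ acts_as T (fun u k => A k *m u k)].

Definition defect_algebra : set (L2 R M -> L2 R M) :=
  smallest subalgebra
    (multiplication_op `|`
     [set T | acts_as T (fun u => avg1 u)] `|`
     [set T | acts_as T (fun u => avg2 u)] `|`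
     compact_op).

Definition defect_form T : Prop :=
  exists (M1 M2 : nat)
    (A0 : R * R -> 'M[R[i]]_(M, M))
    (A1 : R * R -> 'M[R[i]]_(M, M1)) (B1 : R * R -> 'M[R[i]]_(M1, M))
    (A2 : R * R -> 'M[R[i]]_(M, M2)) (B2 : R * R -> 'M[R[i]]_(M2, M))
    (K : L2 R M -> L2 R M),
    [/\ (0 < M1)%N /\ (0 < M2)%N,
        [/\ continuous_mx A0, continuous_mx A1, continuous_mx B1,
            continuous_mx A2 & continuous_mx B2],
        compact_op K
      & acts_as T (fun u k =>
          A0 k *m u k
          + A1 k *m avg1 (fun k' => B1 k' *m u k') k
          + A2 k *m avg2 (fun k' => B2 k' *m u k') k
          + K u k)].
End Operators.

(* Main.v *)
Require Import Defs.
From mathcomp Require Import all_boot all_order all_algebra.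
From mathcomp Require Import all_classical all_reals all_analysis.
From mathcomp Require Import complex unstable measurable_realfun ring lra.

(** Call elementary the multiplications M_A, the composites M_A P1 M_B and
    M_A P2 M_B, where P1 and P2 are the averages over the first and the second
    variable, and the compact operators.  The theorem holds because elementary
    operators are closed under composition ([elementary_op_comp]).  Two
    computations give this.

    An average of A times an average over the same variable is the average of
    A times that average, which does not depend on the variable any more:
    P2 M_A P2 = M_C P2, where C is the average of A over the second variable
    ([avg2_mul_avg2_op]); C is continuous because A is uniformly continuous
    ([continuous_mxavg2]).

    Averages over different variables produce compact operators
    ([cross_op_compact]).  Indeed P2 M_A P1 u is a function of the first
    variable x alone: the integral of A(x, t) against a function of t whose
    L^1 norm is bounded for u in the unit ball.  The modulus of continuity of this
    function of x is controlled by that of A, uniformly over the unit ball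
    ([kernel_integral_modulus]).  By Arzela and Ascoli these functions stay in
    a set that is compact for locally uniform convergence
    ([kernel_modulus_compact]), and such a set is mapped continuously into
    L^2 ([compact_embed_kernel]).

    Hence the finite sums of elementary operators form a subalgebra; it
    contains the generators and lies in every subalgebra that does, so it is
    the defect algebra.  These sums are also the operators of the form in the
    theorem: two terms A <B u> and A' <B' u> are merged into one by putting A
    and A' side by side and B on top of B' ([defect_formD]), and a rectangular
    term A <B u> is the sum over j of the products of the j-th column of A with
    the average of the j-th row of B, both completed by zeros to square
    matrices ([defect_form_elementary]).

    Exchanging the two variables is an operator J with P1 = J P2 J, so the
    analysis is done for P2 only. *)

Set Implicit Arguments.
Unset Strict Implicit.
Unset Printing Implicit Defensive.
Import Order.TTheory GRing.Theory Num.Theory.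
Import numFieldNormedType.Exports.
Local Open Scope classical_set_scope.
Local Open Scope ring_scope.
Local Open Scope complex_scope.
Local Open Scope quotient_scope.

(** * Slices of the unit square and Tonelli's theorem *)
Section UnitSquare.
Context (R : realType).
Local Notation I := (@unit_itv R).
Local Notation S := (@unit_square R).
Local Notation mu := (@lebesgue_measure R).
Implicit Types (f g : R * R -> R) (p : R -> R).

Local Notation measurable_on_S f :=
  (measurable_fun (S : set (measurable_plane R)) f).

Lemma unit_itvE (x : R) : I x = (0 <= x <= 1) :> Prop.
Proof. by rewrite /unit_itv/= in_itv. Qed.

Lemma lebesgue_unit_itv : mu I = 1%E.
Proof. by rewrite /unit_itv lebesgue_measure_itv/= lte01 oppr0 adde0. Qed.

Lemma integrable_cst_itv (c : R) : mu.-integrable I (EFin \o cst c).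
Proof.
apply: (@measurable_bounded_integrable _ _ _ mu) => //.
- exact: measurable_unit_itv.
- by change (mu I < +oo)%E; rewrite lebesgue_unit_itv ltry.
- exact: bounded_cst.
Qed.

Lemma Rintegral_cst_itv (c : R) : \int[mu]_(t in I) c = c.
Proof.
rewrite Rintegral_cst; last exact: measurable_unit_itv.
by rewrite [X in fine X]lebesgue_unit_itv mulr1.
Qed.

Lemma leb2X (A B : set (measurableTypeR R)) : measurable A -> measurable B ->
  (leb2 R (A `*` B) = mu A * mu B)%E.
Proof. exact: product_measure1E. Qed.

Lemma leb2_unit_square : leb2 R S = 1%E.
Proof.
rewrite /unit_square leb2X; [|exact: measurable_unit_itv..].
by rewrite lebesgue_unit_itv mule1.
Qed.

#[export] Instance lebesgue_ae_filter : Filter (nbhs (almost_everywhere mu)).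
Proof. exact: (@ae_filter_ringOfSetsType _ (measurableTypeR R) R mu). Qed.

#[export] Instance leb2_ae_filter : Filter (nbhs (almost_everywhere (leb2 R))).
Proof. exact: (@ae_filter_ringOfSetsType _ (measurable_plane R) R (leb2 R)). Qed.

Lemma integrable_cst_square (c : R) : (leb2 R).-integrable S (EFin \o cst c).
Proof.
apply: (@measurable_bounded_integrable _ _ _ (leb2 R)) => //.
- exact: measurable_unit_square.
-   by rewrite [X in (X < _)%E]leb2_unit_square ltry.
- exact: bounded_cst.
Qed.

Lemma measurable_slice d (V : measurableType d) (f : R * R -> V) x : I x ->
  measurable_fun (S : set (measurable_plane R)) f ->
  measurable_fun (I : set (measurableTypeR R)) (fun t => f (x, t)).
Proof.
move=> Ix mf.
apply: (@measurable_comp _ _ _ _ _ _ (S : set (measurable_plane R)) f I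
  (pair x)) => //.
- exact: measurable_unit_square.
- by move=> _ [t It <-]; split.
- exact: (measurable_funTS (pair1_measurable (x : measurableTypeR R))).
Qed.

(** Slices of the extension by zero of a function on the square; this is how
    Fubini's theorem on the plane is applied to the square. *)
Lemma patch_slice (f : R * R -> \bar R) x t :
  (f \_ S) (x, t) = (if x \in I then ((fun t => f (x, t)) \_ I) t else 0%E).
Proof.
rewrite !patchE.
have -> : ((x, t) \in S) = (x \in I) && (t \in I).
  by apply/idP/idP => [/set_mem[/mem_set -> /mem_set ->]|
    /andP[/set_mem ? /set_mem ?]] //; apply/mem_set.
by case: (x \in I).
Qed.

Lemma integral_slice (f : R * R -> \bar R) x : I x ->
  (\int[mu]_t (f \_ S) (x, t) = \int[mu]_(t in I) f (x, t))%E.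
Proof.
move=> Ix; rewrite [RHS]integral_mkcond; apply: eq_integral => t _.
by rewrite patch_slice mem_set.
Qed.

(** The integral over a slice comes from a difference of two possibly infinite
    integrals of nonnegative functions, each of which depends measurably on the
    slice by Tonelli's theorem. *)
Lemma measurable_avg2 f : measurable_on_S f ->
  measurable_fun (I : set (measurableTypeR R))
    (fun x => \int[mu]_(t in I) f (x, t)).
Proof.
move=> mf.
have mS := @measurable_unit_square R.
have mfS : measurable_fun (setT : set (measurable_plane R)) ((EFin \o f) \_ S).
  apply: (iffLR (measurable_restrictT _ mS)).
  exact/measurable_EFinP.
have mp := measurable_fun_fubini_tonelli_F (m2 := mu) _
  (measurable_funepos mfS) (fun x => funepos_ge0 _ x).
have mn := measurable_fun_fubini_tonelli_F (m2 := mu) _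
  (measurable_funeneg mfS) (fun x => funeneg_ge0 _ x).
apply: (@eq_measurable_fun _ _ _ _ _ (fun x => fine
   (\int[mu]_t (((EFin \o f) \_ S)^\+ (x, t)) -
    \int[mu]_t (((EFin \o f) \_ S)^\- (x, t)))%E)).
  move=> x /set_mem Ix; rewrite /Rintegral -(integral_slice (EFin \o f) Ix).
  rewrite [in RHS]integralE.
  by congr (fine (_ - _)%E); apply: eq_integral => t _; rewrite ?funeposE ?funenegE.
apply: (measurableT_comp (fine_measurable measurableT)).
exact: measurable_funTS (emeasurable_funB mp mn).
Qed.

Lemma tonelli_unit (g : R * R -> \bar R) :
  measurable_fun (S : set (measurable_plane R)) g ->
  (forall k, S k -> 0 <= g k)%E ->
  (\int[leb2 R]_(k in S) g k = \int[mu]_(x in I) \int[mu]_(t in I) g (x, t))%E.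
Proof.
move=> mg g0; have mS := @measurable_unit_square R.
rewrite integral_mkcond fubini_tonelli1.
- rewrite [RHS]integral_mkcond; apply: eq_integral => x _.
  rewrite /fubini_F patchE; case: ifPn => [/set_mem Ix|/negP xI].
    exact: integral_slice.
  rewrite integral0_eq// => t _; rewrite patch_slice.
  by case: ifPn.
- exact: (iffLR (measurable_restrictT _ mS)).
- by move=> k; rewrite patchE; case: ifPn => // /set_mem /g0.
Qed.

Lemma measurable_tonelli_unit (g : R * R -> \bar R) :
  measurable_fun (S : set (measurable_plane R)) g ->
  (forall k, S k -> 0 <= g k)%E ->
  measurable_fun (I : set (measurableTypeR R)) (fun x => \int[mu]_(t in I) g (x, t))%E.
Proof.
move=> mg g0; have mS := @measurable_unit_square R.
apply: (@eq_measurable_fun _ _ _ _ _ (fubini_F mu (g \_ S))).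
  by move=> x /set_mem Ix; rewrite /fubini_F integral_slice.
apply: measurable_funTS; apply: measurable_fun_fubini_tonelli_F.
- exact: (iffLR (measurable_restrictT _ mS)).
- by move=> k; rewrite patchE; case: ifPn => // /set_mem /g0.
Qed.

Lemma tonelli_unit_swap (g : R * R -> \bar R) :
  measurable_fun (S : set (measurable_plane R)) g ->
  (forall k, S k -> 0 <= g k)%E ->
  (\int[leb2 R]_(k in S) g k = \int[mu]_(x in I) \int[mu]_(t in I) g (t, x))%E.
Proof.
move=> mg g0; have mS := @measurable_unit_square R.
rewrite integral_mkcond fubini_tonelli2.
- rewrite [RHS]integral_mkcond; apply: eq_integral => x _.
  rewrite /fubini_G patchE; case: ifPn => [Ix|xI].
    rewrite [RHS]integral_mkcond; apply: eq_integral => t _.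
    by rewrite patch_slice !patchE Ix; case: ifP.
  rewrite integral0_eq// => t _; rewrite patch_slice.
  by case: ifPn => //; rewrite patchE (negbTE xI).
- exact: (iffLR (measurable_restrictT _ mS)).
- by move=> k; rewrite patchE; case: ifPn => // /set_mem /g0.
Qed.

Lemma swap_unit_square (k : R * R) : S k -> S (swap k).
Proof. by case: k => x y []. Qed.

Lemma measurable_fun_swap d (V : measurableType d) (f : R * R -> V) :
  measurable_fun (S : set (measurable_plane R)) f ->
  measurable_fun (S : set (measurable_plane R)) (f \o swap).
Proof.
move=> mf; apply: (@measurable_comp _ _ _ _ _ _ (S : set (measurable_plane R))).
- exact: measurable_unit_square.
- by move=> _ [k /swap_unit_square ? <-].
- exact: mf.
- exact: (measurable_funTS (@measurable_swap _ _ (measurableTypeR R) (measurableTypeR R))).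
Qed.

Lemma integral_swap (g : R * R -> \bar R) :
  measurable_fun (S : set (measurable_plane R)) g ->
  (forall k, S k -> 0 <= g k)%E ->
  (\int[leb2 R]_(k in S) g (swap k) = \int[leb2 R]_(k in S) g k)%E.
Proof.
move=> mg g0; rewrite [RHS]tonelli_unit_swap//.
by rewrite tonelli_unit//; [exact: measurable_fun_swap|move=> k /swap_unit_square/g0].
Qed.

(** The exchange of variables preserves the measure of a null set because the
    integral of its indicator can be computed in either order. *)
Lemma ae_swap (P : R * R -> Prop) :
  {ae leb2 R, forall k, S k -> P k} -> {ae leb2 R, forall k, S k -> P (swap k)}.
Proof.
have mS := @measurable_unit_square R.
case=> N [mN N0 sN].
have msw := @measurable_swap _ _ (measurableTypeR R) (measurableTypeR R).
pose N' : set (measurable_plane R) := S `&` swap @^-1` N.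
have mN' : measurable N'.
  by apply: measurableI => //; rewrite -[X in measurable X]setTI; exact: msw.
exists N'; split => //.
- have : (\int[leb2 R]_(k in S) (\1_N (swap k))%:E = 0)%E.
    rewrite (integral_swap (g := fun k => (\1_N k)%:E)).
    + rewrite integral_indic//; apply/eqP; rewrite eq_le measure_ge0 andbT.
      by rewrite -N0 le_measure ?inE//; exact: measurableI.
    + by apply/measurable_EFinP; exact: measurable_indic.
    + by move=> k _; rewrite lee_fin.
  rewrite (eq_integral (fun k => (\1_(swap @^-1` N) k)%:E)); last by [].
  rewrite integral_indic//; last first.
    by rewrite -[X in measurable X]setTI; exact: msw.
  by rewrite setIC.
- move=> k /= /not_implyP[Sk nP]; split => //.
  by apply: sN => /=; apply/not_implyP; split => //; exact: swap_unit_square.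
Qed.

Lemma ae_fst (P : R -> Prop) :
  {ae mu, forall x, I x -> P x} -> {ae leb2 R, forall k, S k -> P k.1}.
Proof.
case=> N [mN N0 sN].
have mI : measurable (I : set (measurableTypeR R)) := @measurable_unit_itv R.
exists (N `*` I); split.
- exact: measurableX.
- by rewrite leb2X// N0 mul0e.
- by move=> k /= /not_implyP[[I1 I2] nP]; split => //; apply: sN => /= /(_ I1).
Qed.

(** Almost every slice of a null set is null, the measure of a slice having
    integral zero. *)
Lemma ae_slice (P : R * R -> Prop) :
  {ae leb2 R, forall k, S k -> P k} ->
  {ae leb2 R, forall k, S k -> {ae mu, forall t, I t -> P (k.1, t)}}.
Proof.
case=> N [mN N0 sN].
apply: (ae_fst (P := fun x => {ae mu, forall t, I t -> P (x, t)})).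
have mx := @measurable_fun_xsection _ _ (measurableTypeR R) (measurableTypeR R) R mu N mN.
have : {ae mu, forall x, setT x -> (mu \o xsection N) x = 0%E}.
  apply: (ae_eq_integral_abs mu (measurableT : measurable (setT : set (measurableTypeR R))) mx).1.
  by rewrite -[RHS]N0; apply: eq_integral => x _; rewrite gee0_abs.
apply: filterS => x /= /(_ Logic.I) h0 Ix; exists (xsection N x); split => //.
- exact: measurable_xsection mN.
- move=> t /= /not_implyP[It nP]; apply/xsectionP; apply: sN => /=.
  by apply/not_implyP.
Qed.

Lemma ae_integrable_slice f : (leb2 R).-integrable S (EFin \o f) ->
  {ae mu, forall x, I x -> mu.-integrable I (EFin \o (fun t => f (x, t)))}.
Proof.
move=> intf; have mS := @measurable_unit_square R.
have := @ae_integrable1 _ _ (measurableTypeR R) (measurableTypeR R) R mu mu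
  _ ((integrable_mkcond _ mS).1 intf).
apply: filterS => x /= h Ix; apply/integrable_mkcond; first exact: measurable_unit_itv.
by apply: eq_integrable h => // t _; rewrite patch_slice mem_set.
Qed.

(** The interval has finite measure and |p| <= 1 + p^2. *)
Lemma sqr_integrable_itv p :
  measurable_fun (I : set (measurableTypeR R)) p ->
  mu.-integrable I (EFin \o (fun t => p t ^+ 2)) -> mu.-integrable I (EFin \o p).
Proof.
move=> mp ip2; have mI : measurable (I : set (measurableTypeR R)) := @measurable_unit_itv R.
apply: (@le_integrable _ _ _ mu _ mI _ (EFin \o (fun t => cst 1 t + p t ^+ 2))).
- exact/measurable_EFinP.
- move=> t _; rewrite !abse_EFin lee_fin [leRHS]ger0_norm ?addr_ge0 ?sqr_ge0//=.
  rewrite -[p t ^+ 2]real_normK ?num_real//.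
  rewrite -subr_ge0 (_ : _ - _ = (`|p t| - 2^-1) ^+ 2 + 3 / 4); last by field.
  by rewrite addr_ge0 ?sqr_ge0// divr_ge0.
- exact: (integrableD mI (integrable_cst_itv 1) ip2).
Qed.

(** The variance of p is nonnegative: with c the mean of p, expand the integral
    of (p - c)^2. *)
Lemma sqr_Rintegral_le p :
  measurable_fun (I : set (measurableTypeR R)) p ->
  mu.-integrable I (EFin \o (fun t => p t ^+ 2)) ->
  (\int[mu]_(t in I) p t) ^+ 2 <= \int[mu]_(t in I) (p t ^+ 2).
Proof.
move=> mp ip2; have mI : measurable (I : set (measurableTypeR R)) := @measurable_unit_itv R.
have ip := sqr_integrable_itv mp ip2.
set c := \int[mu]_(t in I) p t.
have ic2 : mu.-integrable I (EFin \o (fun t => c * 2 * p t)).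
  exact: (integrableZl mI (c * 2) ip).
have : 0 <= \int[mu]_(t in I) (p t ^+ 2 - c * 2 * p t + c ^+ 2).
  apply: Rintegral_ge0 => t _.
  by rewrite (_ : _ + _ = (p t - c) ^+ 2) ?sqr_ge0//; ring.
rewrite RintegralD//.
- rewrite RintegralB// RintegralZl// -/c Rintegral_cst_itv => h.
  by rewrite -subr_ge0 (le_trans h)// le_eqVlt; apply/orP; left; apply/eqP; ring.
- exact: (integrableB mI ip2 ic2).
- exact: integrable_cst_itv.
Qed.
End UnitSquare.

(** * Continuous matrix functions through their real entries *)
Section ContinuousEntries.
Context (R : realType).
Local Notation I := (@unit_itv R).
Local Notation S := (@unit_square R).
Local Notation mu := (@lebesgue_measure R).
Implicit Types (a : R * R -> R).

Lemma continuous_Re : continuous (@complex.Re R : R[i] -> R).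
Proof.
move=> z.
apply/(@cvgrPdist_le _ R _ _ (nbhs_filter (z : R[i]))) => e e0.
have eC0 : 0 < e%:C by rewrite ltcR.
apply: (@filterS _ (nbhs (z : R[i])) (nbhs_filter (z : R[i])) _ _ _
  (@nbhsx_ballx _ R[i] z _ eC0)) => w.
rewrite -ball_normE/= => /ltW h.
by rewrite -raddfB/= -lecR; apply: le_trans h; exact: normc_ge_Re.
Qed.

Lemma normc_ge_Im (z : R[i]) : `|complex.Im z|%:C <= `|z|.
Proof.
case: z => x y; rewrite normc_def lecR/= -[leLHS]sqrtr_sqr.
by rewrite ler_wsqrtr// lerDr sqr_ge0.
Qed.

Lemma continuous_Im : continuous (@complex.Im R : R[i] -> R).
Proof.
move=> z.
apply/(@cvgrPdist_le _ R _ _ (nbhs_filter (z : R[i]))) => e e0.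
have eC0 : 0 < e%:C by rewrite ltcR.
apply: (@filterS _ (nbhs (z : R[i])) (nbhs_filter (z : R[i])) _ _ _
  (@nbhsx_ballx _ R[i] z _ eC0)) => w.
rewrite -ball_normE/= => /ltW h.
by rewrite -raddfB/= -lecR; apply: le_trans h; exact: normc_ge_Im.
Qed.

Lemma cvg_complex (T : Type) (F : set_system T) (FF : Filter F)
    (f : T -> R[i]) (l : R[i]) :
  complex.Re (f x) @[x --> F] --> complex.Re l ->
  complex.Im (f x) @[x --> F] --> complex.Im l -> f x @[x --> F] --> l.
Proof.
move=> fr fi; apply/(@cvgrPdist_le _ R[i]) => -[e e'].
rewrite ltcE/= => /andP[/eqP -> e0].
have e20 : 0 < e / 2 by rewrite divr_gt0.
near=> x.
have hr : `|complex.Re l - complex.Re (f x)| <= e / 2.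
  by near: x; exact: cvgr_dist_le fr _ e20.
have hi : `|complex.Im l - complex.Im (f x)| <= e / 2.
  by near: x; exact: cvgr_dist_le fi _ e20.
rewrite (complexE (l - f x)) (le_trans (ler_normD _ _))//.
rewrite normrM !normc_def/= !(expr0n, expr1n, addr0, add0r) sqrtr1 mul1r.
rewrite !sqrtr_sqr -rmorphD lecR (splitr e).
by move: hr hi; case: (l) (f x) => [? ?] [? ?] /= ? ?; exact: lerD.
Unshelve. all: by end_near. Qed.

(** All estimates are made on real functions; this lemma moves between them and
    matrix functions. *)
Lemma continuous_mxP (p q : nat) (A : R * R -> 'M[R[i]]_(p, q)) :
  continuous_mx A <-> forall i j,
    {within S, continuous (fun k => complex.Re (A k i j))} /\
    {within S, continuous (fun k => complex.Im (A k i j))}.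
Proof.
split=> [cA i j|cA].
- have cAij : {within S, continuous (fun k => A k i j)}.
    move=> x P h; apply: (cA x [set N : 'M[R[i]]_(p, q) | P (N i j)]).
    exists (fun i' j' => if (i' == i) && (j' == j) then P else setT).
      by move=> i' j'; case: ifPn => [/andP[/eqP -> /eqP ->]|_];
        [exact: h|exact: (@filterT _ _ (nbhs_filter _))].
    by move=> N /(_ i j); rewrite /= !eqxx.
  split=> x.
    exact: (@continuous_comp (subspace S) R[i] R _ _ _ (cAij x) (@continuous_Re _)).
  exact: (@continuous_comp (subspace S) R[i] R _ _ _ (cAij x) (@continuous_Im _)).
- move=> x P [Q hQ sQ]; rewrite nbhs_simpl/=.
  have h i j : nbhs (x : subspace S) [set y | Q i j (A y i j)].
    have [cr ci] := cA i j.
    exact: (@cvg_complex _ _ (nbhs_filter (x : subspace S)) _ _ (cr x) (ci x) _ (hQ i j)).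
  have FF := nbhs_filter (x : subspace S).
  have : nbhs (x : subspace S) [set y | forall i j, Q i j (A y i j)].
    by apply: filter_forall => i; apply: filter_forall => j; exact: h.
  by apply: filterS => y hy; exact: sQ.
Qed.

(** A continuous retraction of the plane onto the square: composing with it
    turns continuity within the square into continuity on the plane. *)
Definition clamp01 (x : R) : R := Num.min (Num.max x 0) 1.
Definition clamp_square (k : R * R) : R * R := (clamp01 k.1, clamp01 k.2).

Lemma clamp01_itv x : I (clamp01 x).
Proof. by rewrite unit_itvE /clamp01 le_min le_max lexx orbT ler01 ge_min lexx orbT. Qed.

Lemma clamp01_id x : I x -> clamp01 x = x.
Proof.
by rewrite unit_itvE /clamp01 => /andP[x0 x1]; rewrite (max_idPl x0) (min_idPl x1).
Qed.

Lemma continuous_clamp01 : continuous clamp01.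
Proof.
move=> x; apply: (@continuous_min _ R (fun x => Num.max x 0) (cst 1)); last exact: cvg_cst.
by apply: (@continuous_max _ R id (cst 0)); [exact: cvg_id|exact: cvg_cst].
Qed.

Lemma clamp_squareP k : S (clamp_square k).
Proof. by split; exact: clamp01_itv. Qed.

Lemma clamp_square_id k : S k -> clamp_square k = k.
Proof. by case: k => x y [] /= Ix Iy; rewrite /clamp_square/= !clamp01_id. Qed.

Lemma continuous_clamp_square : continuous clamp_square.
Proof.
move=> k.
have h1 : clamp01 x.1 @[x --> k] --> clamp01 k.1.
  by apply: (@continuous_comp _ _ _ fst clamp01); [exact: cvg_fst|exact: continuous_clamp01].
have h2 : clamp01 x.2 @[x --> k] --> clamp01 k.2.
  by apply: (@continuous_comp _ _ _ snd clamp01); [exact: cvg_snd|exact: continuous_clamp01].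
exact: (cvg_pair h1 h2).
Qed.

Lemma continuous_extend a : {within S, continuous a} ->
  continuous (a \o clamp_square).
Proof.
move=> /subspace_continuousP ca k.
apply: (@cvg_comp _ _ _ clamp_square a (nbhs k)
  (within S (nbhs (clamp_square k))) _ _ (ca _ (clamp_squareP k))).
move=> P hP; change (nbhs k (clamp_square @^-1` P)).
have H : nbhs k (clamp_square @^-1` [set y | S y -> P y]).
  exact: (continuous_clamp_square hP).
by apply: filterS H => k' /(_ (clamp_squareP k')).
Qed.

Lemma bounded_on_square a : {within S, continuous a} ->
  exists2 C, 0 <= C & forall k, S k -> `|a k| <= C.
Proof.
move=> ca; have cS : compact S.
  by apply: compact_setX; exact: segment_compact.
have [C [_ hC]] := compact_bounded (continuous_compact ca cS).
exists (`|C| + 1) => [|k Sk]; first by rewrite addr_ge0.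
by apply: hC; [rewrite ltr_pwDr// ler_norm|exists k].
Qed.

(** The tube lemma: continuity in x is uniform in t because t ranges over a
    compact interval. *)
Lemma continuous_tube a (x e : R) : continuous a -> 0 < e ->
  \forall y \near x, forall t, I t -> `|a (x, t) - a (y, t)| <= e.
Proof.
move=> ca e0.
have cI : compact I by exact: segment_compact.
have := (compact_near_coveringP I).1 cI R (nbhs x)
  (fun y t => `|a (x, t) - a (y, t)| <= e) _.
apply => t It.
have e20 : 0 < e / 2 by rewrite divr_gt0.
have c1 : continuous (fun k : R * R => a (k.2, k.1)).
  move=> k; apply: (@continuous_comp (R * R)%type (R * R)%type R
    (fun k => (k.2, k.1)) a); last exact: ca.
  exact: (cvg_pair (@cvg_snd _ _ (nbhs k.1) (nbhs k.2) _)
    (@cvg_fst _ _ (nbhs k.1) (nbhs k.2) _)).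
have c2 : continuous (fun k : R * R => a (x, k.1)).
  move=> k; apply: (@continuous_comp (R * R)%type (R * R)%type R
    (fun k => (x, k.1)) a); last exact: ca.
  exact: (cvg_pair (@cvg_cst _ x _ _ _) (@cvg_fst _ _ (nbhs k.1) (nbhs k.2) _)).
have h1 : \forall k \near ((t, x) : R * R), `|a (x, t) - a (k.2, k.1)| <= e / 2.
  exact: (@cvgr_dist_le _ R (R * R)%type (nbhs ((t, x) : R * R)) _ _ _ (c1 (t, x))).
have h2 : \forall k \near ((t, x) : R * R), `|a (x, t) - a (x, k.1)| <= e / 2.
  exact: (@cvgr_dist_le _ R (R * R)%type (nbhs ((t, x) : R * R)) _ _ _ (c2 (t, x))).
apply: filterS (filterI h1 h2) => -[t' y] /= [H1 H2].
rewrite (_ : _ - _ = (a (x, t) - a (y, t')) - (a (x, t) - a (x, t'))); last by ring.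
by rewrite (le_trans (ler_normB _ _))// (splitr e) lerD.
Qed.

(** An open set of the plane is a countable union of rational boxes, so the
    product of the Borel structures contains it. *)
Lemma measurable_open_plane (U : set (R * R)) :
  open U -> measurable (U : set (measurable_plane R)).
Proof.
move=> oU.
pose box (q : (rat * rat) * (rat * rat)) : set (measurable_plane R) :=
  [set` `]ratr q.1.1, ratr q.1.2[%R] `*` [set` `]ratr q.2.1, ratr q.2.2[%R].
have rat_itv (z : R) (C : set R) : nbhs z C ->
    exists p q : rat, [set` `](ratr p : R), ratr q[%R] z /\
      [set` `](ratr p : R), ratr q[%R] `<=` C.
  move=> /nbhs_ballP[e /= e0 sC].
  have /rat_in_itvoo[p] : z - e < z by rewrite ltrBlDr ltrDl.
  have /rat_in_itvoo[q] : z < z + e by rewrite ltrDl.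
  rewrite !in_itv/= => /andP[q1 q2] /andP[p1 p2]; exists p, q.
  split; first by rewrite /= in_itv/= p2.
  move=> y /=; rewrite in_itv/= => /andP[y1 y2]; apply: sC.
  rewrite ball_itv/= in_itv/=.
  by rewrite (lt_trans p1 y1) (lt_trans y2 q2).
have UE : U = \bigcup_q (if `[< box q `<=` U >] then box q else set0).
  apply/seteqP; split=> [[x y] Uxy|k [q _]]; last by case: asboolP => // qU /qU.
  have [[A B] [/= nA nB] sAB] : nbhs (x, y) U by exact: open_nbhs_nbhs.
  have [p1 [q1 [h1 s1]]] := rat_itv _ _ nA.
  have [p2 [q2 [h2 s2]]] := rat_itv _ _ nB.
  exists ((p1, q1), (p2, q2)) => //; case: asboolP => [_|]; first by split.
  by case=> -[x' y'] [/= hx hy]; apply: sAB; split; [exact: s1|exact: s2].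
rewrite UE; apply: countable_bigcupT_measurable => [|q].
  exact: countableP.
by case: ifP => // _; apply: measurableX; exact: measurable_itv.
Qed.

Lemma continuous_measurable_plane a : continuous a ->
  measurable_fun (setT : set (measurable_plane R)) a.
Proof.
move=> /continuousP ca; apply: (measurability _ (RGenOpens.measurableE R)).
move=> _ [_ [x [y ->] <-]]; rewrite setTI; apply: measurable_open_plane.
exact/ca/interval_open.
Qed.

Lemma measurable_on_square a : {within S, continuous a} ->
  measurable_fun (S : set (measurable_plane R)) a.
Proof.
move=> /continuous_extend /continuous_measurable_plane h.
apply: (@eq_measurable_fun _ _ (measurable_plane R) R S (a \o clamp_square)).
  by move=> k /set_mem Sk /=; rewrite clamp_square_id.
exact: measurable_funTS.
Qed.
End ContinuousEntries.

(** * Integrals against continuous kernels *)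
Section ContinuousKernels.
Context (R : realType).
Local Notation I := (@unit_itv R).
Local Notation S := (@unit_square R).
Local Notation mu := (@lebesgue_measure R).
Implicit Types (a : R * R -> R) (p b : R -> R).
Let mI : measurable (I : set (measurableTypeR R)) := @measurable_unit_itv R.

Lemma integrable_bounded_mul b p (C : R) :
  measurable_fun (I : set (measurableTypeR R)) b ->
  (forall t, I t -> `|b t| <= C) -> mu.-integrable I (EFin \o p) ->
  mu.-integrable I (EFin \o (fun t => b t * p t)).
Proof.
move=> mb bC ip.
have mp : measurable_fun (I : set (measurableTypeR R)) p.
  by apply/measurable_EFinP; exact: measurable_int ip.
apply: (@le_integrable _ _ _ mu _ mI _ (EFin \o (fun t => C * p t))).
- by apply/measurable_EFinP; exact: measurable_funM.
- move=> t It; rewrite !abse_EFin lee_fin !normrM ler_wpM2r//.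
  by rewrite (le_trans (bC t It))// ler_norm.
- exact: (integrableZl mI C ip).
Qed.

Lemma Rintegral_bounded_mul b p (C : R) :
  measurable_fun (I : set (measurableTypeR R)) b ->
  (forall t, I t -> `|b t| <= C) -> mu.-integrable I (EFin \o p) ->
  `|\int[mu]_(t in I) (b t * p t)| <= C * \int[mu]_(t in I) `|p t|.
Proof.
move=> mb bC ip; have ibp := integrable_bounded_mul mb bC ip.
have inp : mu.-integrable I (EFin \o (fun t => `|p t|)) by exact: integrable_norm.
rewrite (le_trans (le_normr_Rintegral mI ibp))// -RintegralZl//.
apply: le_Rintegral => //.
- exact: integrable_norm.
- exact: (integrableZl mI C inp).
- by move=> t It; rewrite normrM ler_wpM2r// bC.
Qed.

Section Kernel.
Variable a : R * R -> R.
Hypothesis ca : continuous a.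

Lemma measurable_kernel_slice x :
  measurable_fun (I : set (measurableTypeR R)) (fun t => a (x, t)).
Proof.
have ma := continuous_measurable_plane ca.
exact: (measurable_funTS (measurableT_comp ma (pair1_measurable (x : measurableTypeR R)))).
Qed.

Lemma bounded_kernel_slice x : exists C, forall t, I t -> `|a (x, t)| <= C.
Proof.
have cI : compact I by exact: segment_compact.
have cx : {within I, continuous (fun t => a (x, t))}.
  apply: continuous_subspaceT => t.
  apply: (@continuous_comp R (R * R)%type R (fun t => (x, t)) a); last exact: ca.
  exact: (cvg_pair (@cvg_cst _ x _ _ _) (@cvg_id _ (nbhs t))).
have [C [_ hC]] := compact_bounded (continuous_compact cx cI).
exists (`|C| + 1) => t It.
by apply: hC; [rewrite ltr_pwDr// ler_norm|exists t].
Qed.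

Lemma integrable_kernel_mul p x : mu.-integrable I (EFin \o p) ->
  mu.-integrable I (EFin \o (fun t => a (x, t) * p t)).
Proof.
have [C hC] := bounded_kernel_slice x.
exact: integrable_bounded_mul (measurable_kernel_slice x) hC.
Qed.

Lemma kernel_diff_le p x y e : mu.-integrable I (EFin \o p) ->
  (forall t, I t -> `|a (x, t) - a (y, t)| <= e) ->
  `|\int[mu]_(t in I) (a (x, t) * p t) - \int[mu]_(t in I) (a (y, t) * p t)|
    <= e * \int[mu]_(t in I) `|p t|.
Proof.
move=> ip he; rewrite -RintegralB//; try exact: integrable_kernel_mul.
under eq_Rintegral do rewrite -mulrBl.
apply: (Rintegral_bounded_mul (b := fun t => a (x, t) - a (y, t))) => //.
by apply: measurable_funB; exact: measurable_kernel_slice.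
Qed.

(** The compact set of the Arzela-Ascoli argument.  Its equicontinuity comes
    from the kernel; both of its conditions survive pointwise limits, so it is
    closed. *)
Definition kernel_modulus (C c : R) : set (R -> R) := [set f |
  (forall x, `|f x| <= C) /\
  forall x y e, (forall t, I t -> `|a (x, t) - a (y, t)| <= e) ->
    `|f x - f y| <= c * e].

Lemma kernel_modulus_near C c x e : 0 <= c -> 0 < e ->
  \forall y \near x, forall f, kernel_modulus C c f -> `|f x - f y| < e.
Proof.
move=> c0 e0; have c1 : 0 < c + 1 by rewrite ltr_wpDl.
have e1 : 0 < e / (c + 1) by rewrite divr_gt0.
apply: filterS (continuous_tube x ca e1) => y h f [_ hf].
apply: le_lt_trans (hf _ _ _ h) _.
by rewrite mulrA ltr_pdivrMr// [ltRHS]mulrC ltr_pM2r// ltrDl.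
Qed.

Lemma kernel_modulus_continuous C c f : 0 <= c ->
  kernel_modulus C c f -> continuous f.
Proof.
move=> c0 hf x; apply/cvgrPdist_lt => e e0.
by apply: filterS (kernel_modulus_near C x c0 e0) => y /(_ _ hf).
Qed.

(** The theorem of Arzela and Ascoli gives relative compactness.  The set is
    closed because its conditions involve at most two points at a time and are
    stable under approximation at these points. *)
Lemma kernel_modulus_compact C c : 0 <= c ->
  compact (kernel_modulus C c : set {family compact, R -> R}).
Proof.
move=> c0; set W := kernel_modulus C c.
have pW : precompact (W : set {family compact, R -> R}).
  apply: (@pointwise_precompact_equicontinuous _ _ (@Rhausdorff R)).
  - move=> x; apply: (@precompact_subset _ _ [set` `[- C, C]%R]).
      by move=> _ [f [hf _] <-]; rewrite /= in_itv/= -ler_norml hf.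
    by apply: compact_precompact; [exact: Rhausdorff|exact: segment_compact].
  - move=> x E /=; rewrite -entourage_ballE => -[e /= e0 sE].
    apply: filterS (kernel_modulus_near C x c0 e0) => y h f /h hf.
    by apply: sE; rewrite /= -ball_normE.
rewrite -precompact_closed//.
move=> f clf.
have appr x y d : 0 < d ->
    exists2 g, W g & `|f x - g x| < d /\ `|f y - g y| < d.
  move=> d0; have cK : compact ([set x] `|` [set y]).
    by apply: compactU; exact: compact_set1.
  have entd : entourage [set uv : R * R | ball uv.1 d uv.2].
    exact: entourage_ball (PosNum d0).
  have [g [Wg hg]] := clf _ (fam_nbhs f entd cK).
  exists g => //; split.
  - by have := hg x (or_introl erefl); rewrite /= -ball_normE.
  - by have := hg y (or_intror erefl); rewrite /= -ball_normE.
split=> [x|x y e he].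
- apply/ler_addgt0Pr => d d0; have [g [Wg _] [h _]] := appr x x d d0.
  rewrite -(subrK (g x) (f x)) (le_trans (ler_normD _ _))// addrC lerD//.
  exact: ltW.
- apply/ler_addgt0Pr => d d0; have d2 : 0 < d / 2 by rewrite divr_gt0.
  have [g [_ /(_ _ _ _ he) Wg] [/ltW hx /ltW hy]] := appr x y _ d2.
  rewrite (_ : _ - _ = (g x - g y) + ((f x - g x) - (f y - g y))); last by ring.
  rewrite (le_trans (ler_normD _ _))// lerD// (splitr d).
  by rewrite (le_trans (ler_normB _ _))// lerD.
Qed.

Lemma kernel_integral_modulus C c p : 0 <= C ->
  (forall k, `|a k| <= C) -> mu.-integrable I (EFin \o p) ->
  \int[mu]_(t in I) `|p t| <= c ->
  kernel_modulus (C * c) c (fun x => \int[mu]_(t in I) (a (x, t) * p t)).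
Proof.
move=> C0 aC ip pc; split=> [x|x y e he].
- apply: le_trans (Rintegral_bounded_mul (measurable_kernel_slice x) _ ip) _.
    by move=> t _; exact: aC.
  by rewrite ler_wpM2l.
- have e0 : 0 <= e.
    have I0 : I 0 by rewrite unit_itvE lexx ler01.
    exact: le_trans (he _ I0).
  apply: le_trans (kernel_diff_le ip he) _.
  by rewrite mulrC ler_wpM2r.
Qed.

End Kernel.

(** The average is the integral of the extended kernel against the constant 1,
    so it inherits its modulus of continuity. *)
Lemma continuous_avg2 a : {within S, continuous a} ->
  {within S, continuous (fun k : R * R => \int[mu]_(t in I) a (k.1, t))}.
Proof.
move=> ca; have cA := continuous_extend ca.
have [C C0 hC] := bounded_on_square ca.
have h := @kernel_integral_modulus _ cA C 1 (cst 1) C0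
  (fun k => hC _ (clamp_squareP k)) (integrable_cst_itv 1) _.
have cont : continuous (fun x => \int[mu]_(t in I) ((a \o @clamp_square R) (x, t) * 1)).
  apply: (kernel_modulus_continuous cA ler01 (h _)).
  by rewrite /cst normr1 Rintegral_cst_itv.
apply: (@subspace_eq_continuous _ S R
  ((fun x => \int[mu]_(t in I) ((a \o @clamp_square R) (x, t) * 1)) \o fst)).
- move=> k /set_mem[k1 _] /=; apply: eq_Rintegral => t /set_mem It.
  by rewrite mulr1 clamp_square_id.
- apply: continuous_subspaceT => k.
  by apply: (@continuous_comp _ _ _ fst); [exact: cvg_fst|exact: cont].
Qed.
End ContinuousKernels.

(** * Complex integrals over the unit interval *)
Section ComplexIntegral.
Context (R : realType).
Local Notation I := (@unit_itv R).
Local Notation mu := (@lebesgue_measure R).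
Implicit Types (g h : R -> R[i]) (z w : R[i]).
Let mI : measurable (I : set (measurableTypeR R)) := @measurable_unit_itv R.

Definition cintegrable g : Prop :=
  mu.-integrable I (EFin \o (fun t => complex.Re (g t))) /\
  mu.-integrable I (EFin \o (fun t => complex.Im (g t))).

Lemma complex_ReM z w :
  complex.Re (z * w) = complex.Re z * complex.Re w - complex.Im z * complex.Im w.
Proof. by case: z w => [? ?] []. Qed.

Lemma complex_ImM z w :
  complex.Im (z * w) = complex.Re z * complex.Im w + complex.Im z * complex.Re w.
Proof. by case: z w => [? ?] []. Qed.

Lemma eq_complexP z w :
  complex.Re z = complex.Re w -> complex.Im z = complex.Im w -> z = w.
Proof. by case: z w => [? ?] [? ?] /= -> ->. Qed.

Lemma cintegrable0 : cintegrable (fun=> 0).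
Proof. by split; exact: (integrable_cst_itv (0 : R)). Qed.

Lemma cintegrableD g h : cintegrable g -> cintegrable h ->
  cintegrable (fun t => g t + h t).
Proof.
move=> [gr gi] [hr hi]; split.
- by rewrite (_ : _ \o _ = (fun t => (complex.Re (g t))%:E + (complex.Re (h t))%:E)%E);
    [exact: (integrableD mI gr hr)|apply/funext => t /=; rewrite raddfD].
- by rewrite (_ : _ \o _ = (fun t => (complex.Im (g t))%:E + (complex.Im (h t))%:E)%E);
    [exact: (integrableD mI gi hi)|apply/funext => t /=; rewrite raddfD].
Qed.

Lemma cintegrableZ z g : cintegrable g -> cintegrable (fun t => z * g t).
Proof.
move=> [gr gi]; split.
- rewrite (_ : _ \o _ = (fun t => ((complex.Re z)%:E * (complex.Re (g t))%:E -
    (complex.Im z)%:E * (complex.Im (g t))%:E)%E)); last first.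
    by apply/funext => t /=; rewrite complex_ReM.
  exact: (integrableB mI (integrableZl mI _ gr) (integrableZl mI _ gi)).
- rewrite (_ : _ \o _ = (fun t => ((complex.Re z)%:E * (complex.Im (g t))%:E +
    (complex.Im z)%:E * (complex.Re (g t))%:E)%E)); last first.
    by apply/funext => t /=; rewrite complex_ImM.
  exact: (integrableD mI (integrableZl mI _ gi) (integrableZl mI _ gr)).
Qed.

Lemma eq_cintegral g h : {in I, g =1 h} -> cintegral g = cintegral h.
Proof.
by move=> gh; apply: eq_complexP => /=; apply: eq_Rintegral => t It; rewrite gh.
Qed.

Lemma cintegral0 : cintegral (fun=> 0 : R[i]) = 0.
Proof. by apply: eq_complexP; rewrite /= Rintegral_cst_itv. Qed.

Lemma cintegralD g h : cintegrable g -> cintegrable h ->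
  cintegral (fun t => g t + h t) = cintegral g + cintegral h.
Proof.
move=> [gr gi] [hr hi]; apply: eq_complexP; rewrite raddfD/= -RintegralD//.
- by apply: eq_Rintegral => t _; rewrite raddfD.
- by apply: eq_Rintegral => t _; rewrite raddfD.
Qed.

Lemma cintegralZ z g : cintegrable g ->
  cintegral (fun t => z * g t) = z * cintegral g.
Proof.
move=> [gr gi]; have iZ (c : R) (p : R -> R) : mu.-integrable I (EFin \o p) ->
  mu.-integrable I (EFin \o (fun t => c * p t)).
  by move=> ip; exact: (integrableZl mI c ip).
apply: eq_complexP; rewrite ?complex_ReM ?complex_ImM/= -!RintegralZl//.
- by rewrite -RintegralB//; [apply: eq_Rintegral => t _; rewrite complex_ReM|exact: iZ..].
- by rewrite -RintegralD//; [apply: eq_Rintegral => t _; rewrite complex_ImM|exact: iZ..].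
Qed.

Lemma cintegral_sum n (F : 'I_n -> R -> R[i]) :
  (forall l, cintegrable (F l)) ->
  cintegral (fun t => \sum_(l < n) F l t) = \sum_(l < n) cintegral (F l).
Proof.
move=> iF; suff [] : cintegrable (fun t => \sum_(l < n) F l t) /\
  cintegral (fun t => \sum_(l < n) F l t) = \sum_(l < n) cintegral (F l) by [].
elim: (index_enum _) => [|l s [iS eS]].
  rewrite big_nil; under eq_fun do rewrite big_nil.
  by split; [exact: cintegrable0|exact: cintegral0].
rewrite big_cons -eS; under eq_fun do rewrite big_cons.
by split; [exact: cintegrableD|exact: cintegralD].
Qed.
End ComplexIntegral.

(** * Maps of functions that induce operators on L2 *)
Section L2Maps.
Context (R : realType) (m : nat).
Local Notation I := (@unit_itv R).
Local Notation S := (@unit_square R).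
Local Notation mu := (@lebesgue_measure R).
Local Notation vfun := (R * R -> 'cV[R[i]]_m).
Implicit Types (f g : R * R -> 'cV[R[i]]_m) (F G : vfun -> vfun).
Let mI : measurable (I : set (measurableTypeR R)) := @measurable_unit_itv R.
Let mS : measurable (S : set (measurable_plane R)) := @measurable_unit_square R.

Definition sqint f : R := \int[leb2 R]_(k in S) sqnorm (f k).

(** What makes a map of functions induce a bounded operator on classes.
    Linearity is asked only almost everywhere because an average takes a
    default value on slices that are not integrable. *)
Definition L2_map F : Prop :=
  [/\ exists2 C : R, 0 <= C & forall f, f \in square_integrable ->
        F f \in square_integrable /\ sqint (F f) <= C * sqint f,
      forall f g, f \in square_integrable -> g \in square_integrable ->
        f = g %[ae leb2 R in S] -> F f = F g %[ae leb2 R in S]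
    & forall (a : R[i]) f g, f \in square_integrable -> g \in square_integrable ->
        F (a *: f + g) = a *: F f + F g %[ae leb2 R in S]].

Lemma square_integrable_le f g (C : R) : 0 <= C -> f \in square_integrable ->
  measurable_vec g ->
  (\int[leb2 R]_(k in S) (sqnorm (g k))%:E <=
    C%:E * \int[leb2 R]_(k in S) (sqnorm (f k))%:E)%E ->
  g \in square_integrable /\ sqint g <= C * sqint f.
Proof.
move=> C0 /square_integrableP[mf fi] mg le.
have ffin := integrable_fin_num mS fi.
have gi : (leb2 R).-integrable S (fun k => (sqnorm (g k))%:E).
  apply/integrableP; split.
    by have /measurable_EFinP := measurable_sqnorm mg.
  under eq_integral do rewrite abse_EFin ger0_norm ?sqnorm_ge0//.
  apply: le_lt_trans le _; rewrite -(fineK ffin) -EFinM; exact: ltry.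
split; first exact/square_integrableP.
have gfin := integrable_fin_num mS gi.
by rewrite -lee_fin EFinM /sqint /Rintegral !fineK.
Qed.

Lemma L2fun_sqint (u : L2fun R m) : (u : vfun) \in square_integrable.
Proof. by case: u. Qed.

Lemma L2_map_comp F G : L2_map F -> L2_map G -> L2_map (F \o G).
Proof.
move=> [[C C0 bF] aF lF] [[D D0 bG] aG lG]; split.
- exists (C * D); first exact: mulr_ge0.
  move=> f /bG[gS gD] /=; have [fS fC] := bF _ gS; split => //.
  by rewrite (le_trans fC)// -mulrA ler_wpM2l.
- by move=> f g fS gS /(aG _ _ fS gS); apply: aF; [have [] := bG _ fS|have [] := bG _ gS].
- move=> a f g fS gS /=; have [GfS _] := bG _ fS; have [GgS _] := bG _ gS.
  have afgS : a *: f + g \in square_integrable by rewrite rpredD// rpredZ.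
  have [GafgS _] := bG _ afgS.
  apply: ae_eq_trans (lF a _ _ GfS GgS); apply: aF => //.
  + by rewrite rpredD// rpredZ.
  + exact: lG.
Qed.

(** The value 0 of [insubd] is used only when F u is not square integrable. *)
Definition L2_op F (u : L2 R m) : L2 R m :=
  \pi_(L2 R m) (insubd (0 : L2fun R m) (F u)).

Lemma L2_opE F (u : L2 R m) (h : F u \in square_integrable) :
  L2_op F u = \pi_(L2 R m) (MkL2fun h).
Proof.
by rewrite /L2_op; congr (\pi_(L2 R m) _); apply/val_inj; rewrite /= insubdK.
Qed.

Lemma L2_op_acts F : L2_map F -> acts_as (L2_op F) F.
Proof.
move=> [[C C0 bF] _ _] u; have [h _] := bF _ (L2fun_sqint (repr u)).
by rewrite (L2_opE h); exact: repr_piE.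
Qed.
End L2Maps.

(** * Bounded operators, multiplications and exchange of variables *)
Section L2Operators.
Context (R : realType) (m : nat).
Local Notation I := (@unit_itv R).
Local Notation S := (@unit_square R).
Local Notation mu := (@lebesgue_measure R).
Local Notation vfun := (R * R -> 'cV[R[i]]_m).
Implicit Types (f g : R * R -> 'cV[R[i]]_m) (F G : vfun -> vfun).
Implicit Types (u v : L2 R m) (T : L2 R m -> L2 R m).
Let mI : measurable (I : set (measurableTypeR R)) := @measurable_unit_itv R.
Let mS : measurable (S : set (measurable_plane R)) := @measurable_unit_square R.

Lemma L2_funS u : (u : vfun) \in square_integrable.
Proof. exact: L2fun_sqint. Qed.

Lemma ae_square_sym f g : f = g %[ae leb2 R in S] -> g = f %[ae leb2 R in S].
Proof. by apply: filterS => k h /h. Qed.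

Lemma ae_square_trans f g h : f = g %[ae leb2 R in S] -> g = h %[ae leb2 R in S] ->
  f = h %[ae leb2 R in S].
Proof. by apply: filterS2 => k h1 h2 Sk; rewrite h1// h2. Qed.

Lemma L2_eq_ae u v : (u : vfun) = v %[ae leb2 R in S] -> u = v.
Proof. by move=> h; rewrite -[u]reprK -[v]reprK; exact/L2_eqP. Qed.

Lemma L2_funD u v :
  ((u : vfun) + (v : vfun)) = L2_fun (u + v) %[ae leb2 R in S].
Proof. exact/ae_square_sym/repr_piE. Qed.

Lemma L2_funZ (a : R[i]) u : (a *: (u : vfun)) = L2_fun (a *: u) %[ae leb2 R in S].
Proof. exact/ae_square_sym/repr_piE. Qed.

Lemma ae_eqD f g f' g' : f = f' %[ae leb2 R in S] -> g = g' %[ae leb2 R in S] ->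
  f + g = f' + g' %[ae leb2 R in S].
Proof.
by apply: filterS2 => k h1 h2 Sk; rewrite !fctE (h1 Sk) (h2 Sk).
Qed.

Lemma ae_eqZ (a : R[i]) f f' : f = f' %[ae leb2 R in S] ->
  a *: f = a *: f' %[ae leb2 R in S].
Proof. by move=> h; apply: filterS h => k h Sk; rewrite !fctE (h Sk). Qed.

Lemma L2_op_linear F : L2_map F -> linear (L2_op F).
Proof.
move=> LF; have [[C C0 bF] aF lF] := LF => a u v; apply: L2_eq_ae.
have actF := L2_op_acts LF.
have auvS : a *: L2_fun u + L2_fun v \in square_integrable.
  by rewrite rpredD ?rpredZ ?L2_funS.
have e1 : a *: L2_fun u + L2_fun v = L2_fun (a *: u + v) %[ae leb2 R in S].
  apply: ae_square_trans (L2_funD _ _).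
  by apply: ae_eqD; [exact: L2_funZ|exact: ae_eq_refl].
have e2 := aF _ _ auvS (L2_funS _) e1.
have e3 := lF a _ _ (L2_funS u) (L2_funS v).
have e4 : a *: F (L2_fun u) + F (L2_fun v) =
    L2_fun (a *: L2_op F u + L2_op F v) %[ae leb2 R in S].
  apply: ae_square_trans (L2_funD _ _); apply: ae_eqD; last exact/ae_square_sym/actF.
  by apply: ae_square_trans (L2_funZ _ _); apply: ae_eqZ; exact/ae_square_sym/actF.
exact: (ae_square_trans (actF _) (ae_square_trans (ae_square_sym e2) (ae_square_trans e3 e4))).
Qed.

Lemma sqint_ae f g : f \in square_integrable -> g \in square_integrable ->
  f = g %[ae leb2 R in S] -> sqint f = sqint g.
Proof.
move=> /square_integrableP[mf _] /square_integrableP[mg _] fg.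
rewrite /sqint /Rintegral; congr fine; apply: ge0_ae_eq_integral => //.
- by have /measurable_EFinP := measurable_sqnorm mf.
- by have /measurable_EFinP := measurable_sqnorm mg.
- by move=> k _; rewrite lee_fin sqnorm_ge0.
- by move=> k _; rewrite lee_fin sqnorm_ge0.
- by apply: filterS fg => k h Sk; rewrite h.
Qed.

Lemma L2_normE u : `|u| = (Num.sqrt (sqint u))%:C.
Proof. by []. Qed.

Lemma L2_op_bounded F : L2_map F -> bounded_op (L2_op F).
Proof.
move=> LF; split; first exact: L2_op_linear.
have [[C C0 bF] _ _] := LF; exists (Num.sqrt C) => u.
rewrite !L2_normE -rmorphM lecR -sqrtrM//.
have [FS FC] := bF _ (L2_funS u).
by rewrite (sqint_ae (L2_funS _) FS (L2_op_acts LF u)) ler_wsqrtr.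
Qed.

(** Equalities between products of operators are thereby reduced to equalities
    between maps of functions. *)
Lemma acts_as_comp T1 T2 F G : L2_map F -> L2_map G ->
  acts_as T1 F -> acts_as T2 G -> acts_as (T1 \o T2) (F \o G).
Proof.
move=> [[C C0 bF] aF lF] [[D D0 bG] aG lG] h1 h2 u.
apply: ae_square_trans (h1 _) _; apply: aF; [exact: L2_funS| |exact: h2].
by have [] := bG _ (L2_funS u).
Qed.

Lemma acts_as_ae T F G : acts_as T F ->
  (forall f, f \in square_integrable -> F f = G f %[ae leb2 R in S]) ->
  acts_as T G.
Proof. by move=> h FG u; exact: (ae_square_trans (h u) (FG _ (L2_funS u))). Qed.

Lemma acts_asD T1 T2 (F G : L2 R m -> vfun) : acts_as T1 F -> acts_as T2 G ->
  acts_as (fun u => T1 u + T2 u) (fun u k => F u k + G u k).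
Proof.
move=> h1 h2 u; apply: ae_square_trans; first exact/ae_square_sym/L2_funD.
exact: ae_eqD.
Qed.

Lemma acts_asZ a T (F : L2 R m -> vfun) : acts_as T F ->
  acts_as (fun u => a *: T u) (fun u k => a *: F u k).
Proof.
move=> h u; apply: ae_square_trans; first exact/ae_square_sym/L2_funZ.
exact: ae_eqZ.
Qed.

Lemma acts_as0 : acts_as (fun=> 0 : L2 R m) (fun _ _ => 0).
Proof. by move=> u; exact: repr_piE. Qed.

Lemma acts_as_sum n (T : 'I_n -> L2 R m -> L2 R m)
    (F : 'I_n -> L2 R m -> vfun) :
  (forall j, acts_as (T j) (F j)) ->
  acts_as (fun u => \sum_(j < n) T j u) (fun u k => \sum_(j < n) F j u k).
Proof.
move=> h; elim: (index_enum _) => [|j s IHs] u.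
  rewrite big_nil; apply: ae_square_trans (acts_as0 u) _.
  by apply/aeW => k _; rewrite big_nil.
rewrite big_cons; apply: ae_square_trans (acts_asD (h j) IHs u) _.
by apply/aeW => k _; rewrite big_cons.
Qed.

Definition normsq (z : R[i]) : R := complex.Re z ^+ 2 + complex.Im z ^+ 2.

Lemma normsq_ge0 z : 0 <= normsq z.
Proof. by rewrite addr_ge0 ?sqr_ge0. Qed.

Lemma normsqM z w : normsq (z * w) = normsq z * normsq w.
Proof. by rewrite /normsq complex_ReM complex_ImM; ring. Qed.

Lemma sqrD_le (x y : R) : (x + y) ^+ 2 <= 2 * x ^+ 2 + 2 * y ^+ 2.
Proof.
rewrite -subr_ge0 (_ : _ - _ = (x - y) ^+ 2); last by ring.
exact: sqr_ge0.
Qed.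

(** The crude constant 2 ^ n comes from |x + y|^2 <= 2 |x|^2 + 2 |y|^2 used
    once for each term. *)
Lemma normsq_sum n (z : 'I_n -> R[i]) :
  normsq (\sum_(l < n) z l) <= 2 ^+ n * \sum_(l < n) normsq (z l).
Proof.
rewrite -[in 2 ^+ n](card_ord n) cardE -[enum _]/(enum 'I_n) enumT.
rewrite -[Finite.enum _]/(index_enum _).
elim: (index_enum _) => [|l s IHs].
  by rewrite !big_nil /normsq/= expr0n/= addr0 mulr0.
rewrite !big_cons/= exprS -mulrA mulrDr.
have h2 : 1 <= 2 ^+ size s :> R by rewrite exprn_ege1// ler1n.
have h (x y : R[i]) : normsq (x + y) <= 2 * normsq x + 2 * normsq y.
  rewrite /normsq !raddfD/=.
  have := sqrD_le (complex.Re x) (complex.Re y).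
  by have := sqrD_le (complex.Im x) (complex.Im y); lra.
apply: le_trans (h _ _) _; rewrite mulrDr lerD ?ler_wpM2l//.
by rewrite ler_peMl// normsq_ge0.
Qed.

Lemma sqnorm_mulmx (A : 'M[R[i]]_m) (v : 'cV[R[i]]_m) (B : R) :
  (forall i j, normsq (A i j) <= B) ->
  sqnorm (A *m v) <= m%:R * 2 ^+ m * B * sqnorm v.
Proof.
move=> hB; rewrite -[leRHS]mulrA -[leRHS]mulrA mulr_natl -[m in _ *+ m]card_ord.
rewrite -sumr_const; apply: ler_sum => i _; rewrite mxE.
apply: le_trans (normsq_sum _) _; rewrite ler_wpM2l ?exprn_ge0//.
rewrite mulr_sumr; apply: ler_sum => l _; rewrite normsqM ler_wpM2r//.
exact: normsq_ge0.
Qed.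

Definition mulmap (A : R * R -> 'M[R[i]]_m) (f : vfun) : vfun :=
  fun k => A k *m f k.

Lemma measurable_mulmap A f : continuous_mx A -> measurable_vec f ->
  measurable_vec (mulmap A f).
Proof.
move=> /continuous_mxP cA mf i; split.
- rewrite (_ : (fun k => _) = (fun k => \sum_(l < m)
    (complex.Re (A k i l) * complex.Re (f k l 0) -
     complex.Im (A k i l) * complex.Im (f k l 0)))); last first.
    apply/funext => k; rewrite /mulmap mxE raddf_sum/=.
    by apply: eq_bigr => l _; rewrite complex_ReM.
  apply: measurable_sum => l; have [cr ci] := cA i l; have [fr fi] := mf l.
  by apply: measurable_funB; apply: measurable_funM => //; exact: measurable_on_square.
- rewrite (_ : (fun k => _) = (fun k => \sum_(l < m)
    (complex.Re (A k i l) * complex.Im (f k l 0) +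
     complex.Im (A k i l) * complex.Re (f k l 0)))); last first.
    apply/funext => k; rewrite /mulmap mxE raddf_sum/=.
    by apply: eq_bigr => l _; rewrite complex_ImM.
  apply: measurable_sum => l; have [cr ci] := cA i l; have [fr fi] := mf l.
  by apply: measurable_funD; apply: measurable_funM => //; exact: measurable_on_square.
Qed.

Lemma bounded_entries (A : R * R -> 'M[R[i]]_m) : continuous_mx A ->
  exists2 B, 0 <= B & forall k, S k -> forall i j, normsq (A k i j) <= B.
Proof.
move=> /continuous_mxP cA.
have h i j : exists B, 0 <= B /\ forall k, S k -> normsq (A k i j) <= B.
  have [cr ci] := cA i j.
  have [C C0 hC] := bounded_on_square cr; have [D D0 hD] := bounded_on_square ci.
  exists (C ^+ 2 + D ^+ 2); split=> [|k Sk]; first by rewrite addr_ge0 ?sqr_ge0.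
  rewrite /normsq -(real_normK (num_real (complex.Re _))).
  rewrite -(real_normK (num_real (complex.Im _))).
  by rewrite lerD// ler_pXn2r ?nnegrE// ?hC ?hD.
have [B hB] : {B : 'I_m -> 'I_m -> R | forall i j, 0 <= B i j /\
    forall k, S k -> normsq (A k i j) <= B i j}.
  exists (fun i j => projT1 (cid (h i j))) => i j.
  exact: projT2 (cid (h i j)).
exists (\sum_i \sum_j B i j).
  by apply: sumr_ge0 => i _; apply: sumr_ge0 => j _; case: (hB i j).
move=> k Sk i j; apply: le_trans ((hB i j).2 _ Sk) _.
rewrite (bigD1 i)//= (bigD1 j)//= -addrA lerDl addr_ge0//.
- by apply: sumr_ge0 => j' _; case: (hB i j').
- by apply: sumr_ge0 => i' _; apply: sumr_ge0 => j' _; case: (hB i' j').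
Qed.

(** The bound holds pointwise, the entries of A being bounded on the compact
    square. *)
Lemma L2_map_mul A : continuous_mx A -> L2_map (mulmap A).
Proof.
move=> cA; have [B B0 hB] := bounded_entries cA; split.
- have C0 : 0 <= m%:R * 2 ^+ m * B by rewrite !mulr_ge0.
  exists (m%:R * 2 ^+ m * B) => // f fS.
  have /square_integrableP[mf fi] := fS.
  have mAf := measurable_mulmap cA mf.
  apply: square_integrable_le => //.
  rewrite -ge0_integralZl//.
  + apply: ge0_le_integral => //.
    * by move=> k _; rewrite lee_fin sqnorm_ge0.
    * by have /measurable_EFinP := measurable_sqnorm mAf.
    * by apply: measurable_funeM; have /measurable_EFinP := measurable_sqnorm mf.
    * by move=> k Sk; rewrite -EFinM lee_fin; exact: sqnorm_mulmx (hB k Sk).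
  + by have /measurable_EFinP := measurable_sqnorm mf.
  + by move=> k _; rewrite lee_fin sqnorm_ge0.
- move=> f g _ _ fg; apply: filterS fg => k h Sk.
  by rewrite /mulmap (h Sk).
- move=> a f g _ _; apply/aeW => k _.
  by rewrite /mulmap mulmxDr -scalemxAr.
Qed.

Definition swapmap (f : vfun) : vfun := f \o swap.

Lemma L2_map_swap : L2_map swapmap.
Proof.
split.
- exists 1 => // f fS; have /square_integrableP[mf fi] := fS.
  have mf' : measurable_vec (swapmap f).
    by move=> j; have [fr fi'] := mf j; split;
      [exact: (measurable_fun_swap fr)|exact: (measurable_fun_swap fi')].
  apply: square_integrable_le => //.
  rewrite mul1e le_eqVlt; apply/orP; left; apply/eqP.
  apply: (integral_swap (g := fun k => (sqnorm (f k))%:E)).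
  + by have /measurable_EFinP := measurable_sqnorm mf.
  + by move=> k _; rewrite lee_fin sqnorm_ge0.
- by move=> f g _ _ fg; exact: (ae_swap fg).
- by move=> a f g _ _; apply/aeW => k _.
Qed.
End L2Operators.

(** * Averages over the second variable *)
Section Averaging.
Context (R : realType) (m : nat).
Local Notation I := (@unit_itv R).
Local Notation S := (@unit_square R).
Local Notation mu := (@lebesgue_measure R).
Local Notation vfun := (R * R -> 'cV[R[i]]_m).
Implicit Types (f g : R * R -> 'cV[R[i]]_m) (A : R * R -> 'M[R[i]]_m).
Let mI : measurable (I : set (measurableTypeR R)) := @measurable_unit_itv R.
Let mS : measurable (S : set (measurable_plane R)) := @measurable_unit_square R.

Lemma measurable_avg2_vec f : measurable_vec f -> measurable_vec (avg2 f).
Proof.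
move=> mf j; have [mr mi] := mf j.
have lift (p : R -> R) : measurable_fun (I : set (measurableTypeR R)) p ->
    measurable_fun (S : set (measurable_plane R)) (p \o fst).
  move=> mp; apply: (@measurable_comp _ _ _ _ _ _ (I : set (measurableTypeR R))) => //.
  - by move=> _ [k [k1 _] <-].
  - exact: (measurable_funTS (@measurable_fst _ _ (measurableTypeR R) (measurableTypeR R))).
split.
- apply: (eq_measurable_fun _ _ (lift _ (measurable_avg2 mr))).
  by move=> k _ /=; rewrite mxE.
- apply: (eq_measurable_fun _ _ (lift _ (measurable_avg2 mi))).
  by move=> k _ /=; rewrite mxE.
Qed.

Lemma sqr_entry_le_sqnorm (v : 'cV[R[i]]_m) j :
  complex.Re (v j 0) ^+ 2 <= sqnorm v /\ complex.Im (v j 0) ^+ 2 <= sqnorm v.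
Proof.
have h : complex.Re (v j 0) ^+ 2 + complex.Im (v j 0) ^+ 2 <= sqnorm v.
  rewrite /sqnorm (bigD1 j)//= lerDl; apply: sumr_ge0 => i _.
  by rewrite addr_ge0 ?sqr_ge0.
by split; apply: le_trans h; rewrite ?lerDl ?lerDr sqr_ge0.
Qed.

Lemma measurable_vec_slice f x : I x -> measurable_vec f -> forall j,
  measurable_fun (I : set (measurableTypeR R)) (fun t => complex.Re (f (x, t) j 0)) /\
  measurable_fun (I : set (measurableTypeR R)) (fun t => complex.Im (f (x, t) j 0)).
Proof.
by move=> Ix mf j; have [mr mi] := mf j; split;
  [exact: (measurable_slice Ix mr)|exact: (measurable_slice Ix mi)].
Qed.

Lemma integrable_slice_entries f x : I x -> measurable_vec f ->
  mu.-integrable I (EFin \o (fun t => sqnorm (f (x, t)))) -> forall j,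
  mu.-integrable I (EFin \o (fun t => complex.Re (f (x, t) j 0) ^+ 2)) /\
  mu.-integrable I (EFin \o (fun t => complex.Im (f (x, t) j 0) ^+ 2)).
Proof.
move=> Ix mf ig j; have [mr mi] := measurable_vec_slice Ix mf j.
split; apply: (@le_integrable _ _ _ mu _ mI _ _ _ _ ig).
- by apply/measurable_EFinP; exact: measurable_funX.
- move=> t _; rewrite !abse_EFin lee_fin !ger0_norm ?sqr_ge0 ?sqnorm_ge0//.
  by have [] := sqr_entry_le_sqnorm (f (x, t)) j.
- by apply/measurable_EFinP; exact: measurable_funX.
- move=> t _; rewrite !abse_EFin lee_fin !ger0_norm ?sqr_ge0 ?sqnorm_ge0//.
  by have [] := sqr_entry_le_sqnorm (f (x, t)) j.
Qed.

Lemma cintegrable_slice f x : I x -> measurable_vec f ->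
  mu.-integrable I (EFin \o (fun t => sqnorm (f (x, t)))) -> forall j,
  cintegrable (fun t => f (x, t) j 0).
Proof.
move=> Ix mf ig j; have [mr mi] := measurable_vec_slice Ix mf j.
have [ir ii] := integrable_slice_entries Ix mf ig j.
by split; exact: sqr_integrable_itv.
Qed.

Lemma sqnorm_avg2_le f x y : I x -> measurable_vec f ->
  mu.-integrable I (EFin \o (fun t => sqnorm (f (x, t)))) ->
  sqnorm (avg2 f (x, y)) <= \int[mu]_(t in I) sqnorm (f (x, t)).
Proof.
move=> Ix mf ig; rewrite /sqnorm.
have h (s : seq 'I_m) : \sum_(j <- s) (complex.Re (avg2 f (x, y) j 0) ^+ 2 +
    complex.Im (avg2 f (x, y) j 0) ^+ 2) <=
  \int[mu]_(t in I) \sum_(j <- s) (complex.Re (f (x, t) j 0) ^+ 2 +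
    complex.Im (f (x, t) j 0) ^+ 2) /\
  mu.-integrable I (EFin \o (fun t => \sum_(j <- s) (complex.Re (f (x, t) j 0) ^+ 2 +
    complex.Im (f (x, t) j 0) ^+ 2))).
  elim: s => [|j s [IHs iS]].
    rewrite big_nil; under eq_Rintegral do rewrite big_nil.
    rewrite Rintegral_cst_itv; split => //.
    by under eq_fun do rewrite big_nil; exact: (integrable_cst_itv (0 : R)).
  have [mr mi] := measurable_vec_slice Ix mf j.
  have [ir ii] := integrable_slice_entries Ix mf ig j.
  have iri : mu.-integrable I (EFin \o (fun t => complex.Re (f (x, t) j 0) ^+ 2 +
     complex.Im (f (x, t) j 0) ^+ 2)) by exact: (integrableD mI ir ii).
  rewrite big_cons; under eq_Rintegral do rewrite big_cons.
  split.
    rewrite RintegralD// lerD// RintegralD// mxE/=.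
    by rewrite lerD// sqr_Rintegral_le.
  by under eq_fun do rewrite big_cons; exact: (integrableD mI iri iS).
exact: (h _).1.
Qed.

(** Jensen's inequality on a slice; when the slice is not square integrable the
    right-hand side is infinite. *)
Lemma avg2_lee f x y : I x -> measurable_vec f ->
  ((sqnorm (avg2 f (x, y)))%:E <= \int[mu]_(t in I) (sqnorm (f (x, t)))%:E)%E.
Proof.
move=> Ix mf.
have msq : measurable_fun (I : set (measurableTypeR R))
    (EFin \o (fun t => sqnorm (f (x, t)))).
  by apply/measurable_EFinP; exact: (measurable_slice Ix (measurable_sqnorm mf)).
have [fin|] := boolP ((\int[mu]_(t in I) (sqnorm (f (x, t)))%:E)%E < +oo)%E; last first.
  by rewrite -leNgt leye_eq => /eqP ->; exact: leey.
have ig : mu.-integrable I (EFin \o (fun t => sqnorm (f (x, t)))).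
  apply/integrableP; split => //.
  by under eq_integral do rewrite abse_EFin ger0_norm ?sqnorm_ge0//.
rewrite -[leRHS]fineK; last exact: (integrable_fin_num mI ig).
by rewrite lee_fin; exact: sqnorm_avg2_le.
Qed.

Lemma integral_const_itv (e : \bar R) : (\int[mu]_(t in I) e = e)%E.
Proof.
rewrite integral_cst; last exact: mI.
by rewrite [X in (_ * X)%E]lebesgue_unit_itv mule1.
Qed.

Lemma square_integrable_avg2 f : f \in square_integrable ->
  avg2 f \in square_integrable /\ sqint (avg2 f) <= sqint f.
Proof.
move=> fS; have /square_integrableP[mf fi] := fS.
have mav := measurable_avg2_vec mf.
have msq := measurable_sqnorm mf.
rewrite -[X in _ <= X]mul1r; apply: square_integrable_le => //.
have mE : measurable_fun (S : set (measurable_plane R)) (fun k => (sqnorm (f k))%:E).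
  exact/measurable_EFinP.
have mavE : measurable_fun (S : set (measurable_plane R))
    (fun k => (sqnorm (avg2 f k))%:E).
  by apply/measurable_EFinP; exact: measurable_sqnorm.
have f0 k : S k -> (0 <= (sqnorm (f k))%:E)%E by rewrite lee_fin sqnorm_ge0.
have av0 k : S k -> (0 <= (sqnorm (avg2 f k))%:E)%E by rewrite lee_fin sqnorm_ge0.
rewrite mul1e (tonelli_unit mE f0) (tonelli_unit mavE av0).
apply: ge0_le_integral => //.
- by move=> x Ix; apply: integral_ge0 => t It; rewrite lee_fin sqnorm_ge0.
- exact: (measurable_tonelli_unit mavE av0).
- exact: (measurable_tonelli_unit mE f0).
- move=> x Ix; rewrite -[leRHS]integral_const_itv; apply: ge0_le_integral => //.
  + by move=> y Iy; rewrite lee_fin sqnorm_ge0.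
  + exact: (measurable_slice Ix mavE).
  + by move=> y Iy; exact: avg2_lee.
Qed.

Lemma L2_map_avg2 : L2_map (@avg2 R m).
Proof.
split.
- by exists 1 => // f fS; rewrite mul1r; exact: square_integrable_avg2.
- move=> f g /square_integrableP[mf _] /square_integrableP[mg _].
  move=> /ae_slice; apply: filterS => -[x y] h Sk; have {}h := h Sk.
  have [Ix _] := Sk; apply/colP => j; rewrite !mxE.
  have [mfr mfi] := measurable_vec_slice Ix mf j.
  have [mgr mgi] := measurable_vec_slice Ix mg j.
  apply: eq_complexP => /=; congr fine; apply: ae_eq_integral => //.
  + exact/measurable_EFinP.
  + exact/measurable_EFinP.
  + by apply: filterS h => t /= h It; rewrite h.
  + exact/measurable_EFinP.
  + exact/measurable_EFinP.
  + by apply: filterS h => t /= h It; rewrite h.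
- move=> a f g /square_integrableP[mf fi] /square_integrableP[mg gi].
  have := ae_fst (ae_integrable_slice gi); apply: filterS2 (ae_fst (ae_integrable_slice fi)).
  move=> [x y] hf hg Sk; have [Ix _] := Sk.
  have cf := cintegrable_slice Ix mf (hf Sk); have cg := cintegrable_slice Ix mg (hg Sk).
  apply/colP => j; rewrite !mxE -cintegralZ// -cintegralD//; last exact: cintegrableZ.
  by apply: eq_cintegral => t _; rewrite !mxE.
Qed.

Definition mxavg2 A : R * R -> 'M[R[i]]_m :=
  fun k => \matrix_(i, j) cintegral (fun t => A (k.1, t) i j).

Lemma continuous_mxavg2 A : continuous_mx A -> continuous_mx (mxavg2 A).
Proof.
move=> /continuous_mxP cA; apply/continuous_mxP => i j; have [cr ci] := cA i j.
split.
- rewrite (_ : (fun k => _) = (fun k : R * R =>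
    \int[mu]_(t in I) complex.Re (A (k.1, t) i j))); first exact: (continuous_avg2 cr).
  by apply/funext => k; rewrite mxE.
- rewrite (_ : (fun k => _) = (fun k : R * R =>
    \int[mu]_(t in I) complex.Im (A (k.1, t) i j))); first exact: (continuous_avg2 ci).
  by apply/funext => k; rewrite mxE.
Qed.

Lemma cintegrable_continuous A x i j : I x -> continuous_mx A ->
  cintegrable (fun t => A (x, t) i j).
Proof.
move=> Ix /continuous_mxP cA; have [cr ci] := cA i j.
have h (a : R * R -> R) : {within S, continuous a} ->
    mu.-integrable I (EFin \o (fun t => a (x, t))).
  move=> ca; have [C C0 hC] := bounded_on_square ca.
  apply: (@measurable_bounded_integrable _ _ _ mu) => //.
  - by change (mu I < +oo)%E; rewrite lebesgue_unit_itv ltry.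
  - exact: (measurable_slice Ix (measurable_on_square ca)).
  - exists C; split; first exact: num_real.
    by move=> D CD t It; exact: (le_trans (hC (x, t) (conj Ix It)) (ltW CD)).
by split; [exact: (h _ cr)|exact: (h _ ci)].
Qed.

(** On the slice at x the inner average is constant, so it leaves the
    integral. *)
Lemma avg2_mul_avg2 A f k : continuous_mx A -> S k ->
  avg2 (mulmap A (avg2 f)) k = mulmap (mxavg2 A) (avg2 f) k.
Proof.
case: k => x y cA [Ix Iy]; apply/colP => i; rewrite !mxE.
transitivity (cintegral (fun t => \sum_(l < m)
    avg2 f (x, y) l 0 * A (x, t) i l)).
  apply: eq_cintegral => t _; rewrite mxE; apply: eq_bigr => l _.
  by rewrite mulrC !mxE.
rewrite cintegral_sum; last first.
  by move=> l; apply: cintegrableZ; exact: cintegrable_continuous.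
apply: eq_bigr => l _; rewrite cintegralZ; last exact: cintegrable_continuous.
by rewrite mulrC !mxE.
Qed.
End Averaging.

(** * The ideal of compact operators *)
Section CompactOperators.
Context (R : realType) (m : nat).
Local Notation E := (L2 R m).
Implicit Types (u v : E) (T K B : E -> E).

Lemma bounded_op_linear T : bounded_op T -> linear T.
Proof. by case. Qed.

Lemma linear_op0 T : linear T -> T 0 = 0.
Proof. by move=> lT; have := lT (-1) 0 0; rewrite scaler0 addr0 scaleN1r addNr. Qed.

Lemma linear_opD T u v : linear T -> T (u + v) = T u + T v.
Proof. by move=> lT; have := lT 1 u v; rewrite !scale1r. Qed.

Lemma linear_opZ T (a : R[i]) u : linear T -> T (a *: u) = a *: T u.
Proof. by move=> lT; have := lT a u 0; rewrite !addr0 (linear_op0 lT) addr0. Qed.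

Lemma linear_op_sum T n (F : 'I_n -> E) : linear T ->
  T (\sum_(j < n) F j) = \sum_(j < n) T (F j).
Proof.
move=> lT; elim: (index_enum _) => [|j s IHs].
  by rewrite !big_nil linear_op0.
by rewrite !big_cons linear_opD// IHs.
Qed.

Lemma bounded_opP T : bounded_op T ->
  exists2 C : R, 0 < C & forall u, `|T u| <= C%:C * `|u|.
Proof.
move=> [_ [C hC]]; exists (`|C| + 1); first by rewrite ltr_pwDr.
move=> u; apply: le_trans (hC u) _; rewrite ler_wpM2r// lecR.
by rewrite (le_trans (ler_norm C))// lerDl.
Qed.

Lemma bounded_op_continuous T : bounded_op T -> continuous T.
Proof.
move=> bT; have lT := bounded_op_linear bT; have [C C0 hC] := bounded_opP bT.
have CC0 : 0 < C%:C by rewrite ltcR.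
move=> u; apply/(@cvgrPdist_lt _ E _ _ (nbhs_filter (u : E))) => e e0.
have eC0 : 0 < e / C%:C by rewrite divr_gt0.
apply: filterS (@nbhsx_ballx _ E u _ eC0) => v; rewrite -ball_normE/= => h.
have -> : T u - T v = T (u - v).
  by rewrite -scaleN1r addrC -lT addrC scaleN1r.
by rewrite (le_lt_trans (hC _))// mulrC -ltr_pdivlMr.
Qed.

Lemma bounded_op0 : bounded_op (fun=> 0 : E).
Proof.
split; first by move=> a u v; rewrite scaler0 addr0.
by exists 0 => u; rewrite normr0 mul0r.
Qed.

Lemma bounded_opD T1 T2 : bounded_op T1 -> bounded_op T2 ->
  bounded_op (fun u => T1 u + T2 u).
Proof.
move=> [l1 [C1 h1]] [l2 [C2 h2]]; split.
  by move=> a u v; rewrite l1 l2 scalerDr addrACA.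
exists (C1 + C2) => u; rewrite rmorphD mulrDl (le_trans (ler_normD _ _))//.
exact: lerD.
Qed.

Lemma bounded_opZ (a : R[i]) T : bounded_op T -> bounded_op (fun u => a *: T u).
Proof.
move=> [l [C h]]; split.
  by move=> b u v; rewrite l scalerDr !scalerA mulrC.
exists (Num.sqrt (complex.Re a ^+ 2 + complex.Im a ^+ 2) * C) => u.
rewrite normrZ [`|a|]normc_def rmorphM -mulrA ler_wpM2l//.
by rewrite lecR sqrtr_ge0.
Qed.

Lemma bounded_op_comp T1 T2 : bounded_op T1 -> bounded_op T2 ->
  bounded_op (T1 \o T2).
Proof.
move=> b1 [l2 [C2 h2]]; have [C1 C10 h1] := bounded_opP b1; have [l1 _] := b1.
split; first by move=> a u v /=; rewrite l2 l1.
exists (C1 * C2) => u /=; rewrite (le_trans (h1 _))// rmorphM -mulrA.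
by rewrite ler_pM2l// ltcR.
Qed.

(** With [compact_op_elim], lets compactness of an operator be checked with any
    compact set containing the image of the unit ball, L2 being Hausdorff. *)
Lemma compact_op_intro T (K : set E) : linear T -> compact K ->
  (forall u, `|u| <= 1 -> K (T u)) -> compact_op T.
Proof.
move=> lT cK sK; split => //.
apply: (@precompact_subset _ _ K); first by move=> _ [u u1 <-]; exact: sK.
by apply: compact_precompact => //; exact: norm_hausdorff.
Qed.

Lemma compact_op_elim T : compact_op T ->
  exists2 K : set E, compact K & forall u, `|u| <= 1 -> K (T u).
Proof.
move=> [_]; rewrite precompactE => cK; exists (closure (T @` [set u | `|u| <= 1])) => //.
by move=> u u1; apply: subset_closure; exists u.
Qed.

Lemma compact_norm_bounded (K : set E) : compact K ->
  exists2 C : R, 0 < C & forall u, K u -> `|u| <= C%:C.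
Proof.
move=> cK.
have cn : continuous (fun u : E => complex.Re `|u| : R).
  move=> u; apply: (@continuous_comp E R[i] R); last exact: continuous_Re.
  exact: norm_continuous.
have [C [_ hC]] := compact_bounded (continuous_compact (continuous_subspaceT cn) cK).
exists (`|C| + 1); first by rewrite ltr_pwDr.
move=> u Ku; have C1 : C < `|C| + 1 by rewrite ltr_pwDr// ler_norm.
have h : `|complex.Re `|u| : R| <= `|C| + 1 by apply: (hC _ C1); exists u.
by rewrite L2_normE lecR; exact: le_trans (ler_norm _) h.
Qed.

(** The norm is bounded on a compact set that contains the image of the unit
    ball; homogeneity does the rest. *)
Lemma compact_op_bounded : @compact_op R m `<=` @bounded_op R m.
Proof.
move=> T cT; have [lT _] := cT; split => //.
have [K cK hK] := compact_op_elim cT; have [C C0 hC] := compact_norm_bounded cK.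
exists C => u; have [->|u0] := eqVneq u 0.
  by rewrite (linear_op0 lT) !normr0 mulr0.
have nu0 : `|u| != 0 by rewrite normr_eq0.
have h1 : `| `|u|^-1 *: u | <= 1.
  by rewrite normrZ normfV normr_id mulVf.
have := hC _ (hK _ h1); rewrite linear_opZ// normrZ normfV normr_id.
by rewrite mulrC ler_pdivrMr// normr_gt0.
Qed.

Lemma compact_op0 : compact_op (fun=> 0 : E).
Proof.
apply: (@compact_op_intro _ [set 0]) => //; last exact: compact_set1.
exact: (bounded_op0).1.
Qed.

Lemma compact_opD T1 T2 : compact_op T1 -> compact_op T2 ->
  compact_op (fun u => T1 u + T2 u).
Proof.
move=> c1 c2; have [K1 cK1 h1] := compact_op_elim c1.
have [K2 cK2 h2] := compact_op_elim c2.
have cK : compact ((fun x : E * E => x.1 + x.2) @` (K1 `*` K2)).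
  apply: continuous_compact; last exact: compact_setX.
  by apply: continuous_subspaceT; exact: add_continuous.
apply: (compact_op_intro _ cK).
- exact: (bounded_opD (compact_op_bounded c1) (compact_op_bounded c2)).1.
- by move=> u u1; exists (T1 u, T2 u) => //; split; [exact: h1|exact: h2].
Qed.

Lemma compact_op_sum n (T : 'I_n -> E -> E) : (forall j, compact_op (T j)) ->
  compact_op (fun u => \sum_(j < n) T j u).
Proof.
move=> h; elim: (index_enum _) => [|j s IHs].
  by under eq_fun do rewrite big_nil; exact: compact_op0.
by under eq_fun do rewrite big_cons; exact: compact_opD.
Qed.

Lemma bounded_compact_op B T : bounded_op B -> compact_op T ->
  compact_op (B \o T).
Proof.
move=> bB cT; have [K cK h] := compact_op_elim cT.
apply: (@compact_op_intro _ (B @` K)).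
- exact: (bounded_op_comp bB (compact_op_bounded cT)).1.
- apply: continuous_compact => //; apply: continuous_subspaceT.
  exact: bounded_op_continuous.
- by move=> u u1; exists (T u) => //; exact: h.
Qed.

Lemma bounded_op_id : bounded_op (fun u : E => u).
Proof. by split => //; exists 1 => u; rewrite mul1r. Qed.

Lemma compact_opZ (a : R[i]) T : compact_op T -> compact_op (fun u => a *: T u).
Proof. exact: (bounded_compact_op (bounded_opZ a bounded_op_id)). Qed.

(** B maps the unit ball into a multiple C of it, so T B maps it into C times
    the compact set attached to T. *)
Lemma compact_bounded_op B T : bounded_op B -> compact_op T ->
  compact_op (T \o B).
Proof.
move=> bB cT; have [K cK h] := compact_op_elim cT; have [lT _] := cT.
have [C C0 hC] := bounded_opP bB.
have CC0 : 0 < C%:C by rewrite ltcR.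
apply: (@compact_op_intro _ ((fun u => C%:C *: u) @` K)).
- exact: (bounded_op_comp (compact_op_bounded cT) bB).1.
- apply: continuous_compact => //; apply: continuous_subspaceT.
  exact: (bounded_op_continuous (bounded_opZ C%:C bounded_op_id)).
- move=> u u1; exists (T (C%:C^-1 *: B u)).
    apply: h; rewrite normrZ normfV gtr0_norm// mulrC ler_pdivrMr// mul1r.
    by rewrite (le_trans (hC u))// ler_piMr// ltW.
  by rewrite /= linear_opZ// scalerA divff ?scale1r// gt_eqF.
Qed.
End CompactOperators.

(** * From uniform compactness to compactness in L2 *)
Section KernelCompact.
Context (R : realType) (m : nat).
Local Notation I := (@unit_itv R).
Local Notation S := (@unit_square R).
Local Notation mu := (@lebesgue_measure R).
Local Notation E := (L2 R m).
Local Notation vfun := (R * R -> 'cV[R[i]]_m).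
Implicit Types (u v : E) (f g : R * R -> 'cV[R[i]]_m) (A : R * R -> 'M[R[i]]_m).
Let mI : measurable (I : set (measurableTypeR R)) := @measurable_unit_itv R.
Let mS : measurable (S : set (measurable_plane R)) := @measurable_unit_square R.

(** The real and imaginary parts of the entries of the composite averages are
    of this shape. *)
Definition embed_fst (j : 'I_m) (p : R -> R) : vfun :=
  fun k => (p k.1)%:C *: delta_mx j 0.

Lemma sqnorm_embed_fst j p k : sqnorm (embed_fst j p k) = p k.1 ^+ 2.
Proof.
rewrite /embed_fst sqnormZ/= expr0n/= addr0 /sqnorm (bigD1 j)//=.
rewrite big1 => [|i ij]; first by rewrite mxE !eqxx/= expr1n expr0n/= !addr0 mulr1.
by rewrite mxE (negbTE ij)/= expr0n/= addr0.
Qed.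

Lemma square_integrable_embed_fst j p : continuous p ->
  embed_fst j p \in square_integrable.
Proof.
move=> cp.
have c1 : {within S, continuous (fun k : R * R => p k.1)}.
  apply: continuous_subspaceT => k.
  by apply: (@continuous_comp _ _ _ fst p); [exact: cvg_fst|exact: cp].
have mp := measurable_on_square c1.
apply/square_integrableP; split.
  move=> i; split.
  - rewrite (_ : (fun k => _) = (fun k : R * R => p k.1 * (i == j)%:R)).
      by apply: measurable_funM => //; exact: measurable_cst.
    by apply/funext => k; rewrite /embed_fst !mxE andbT; case: (i == j);
      rewrite ?mulr1 ?mulr0//= ?mulr1 ?mulr0 ?subr0.
  - rewrite (_ : (fun k => _) = (fun k : R * R => 0)); first exact: measurable_cst.
    by apply/funext => k; rewrite /embed_fst !mxE andbT; case: (i == j);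
      rewrite ?mulr1 ?mulr0.
under eq_fun do rewrite sqnorm_embed_fst.
have [C C0 hC] := bounded_on_square c1.
apply: (@le_integrable _ _ _ (leb2 R) _ mS _ (EFin \o cst (C ^+ 2))).
- by apply/measurable_EFinP; exact: measurable_funX.
- move=> k Sk; rewrite !abse_EFin lee_fin !ger0_norm ?sqr_ge0//=.
  by rewrite -real_normK ?num_real// ler_pXn2r ?nnegrE// hC.
- exact: integrable_cst_square.
Qed.

Definition embed_fst_L2 (j : 'I_m) (p : R -> R) : E :=
  \pi_E (insubd (0 : L2fun R m) (embed_fst j p)).

Lemma embed_fst_L2_ae j p : continuous p ->
  L2_fun (embed_fst_L2 j p) = embed_fst j p %[ae leb2 R in S].
Proof.
move=> cp; have h := square_integrable_embed_fst j cp.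
have -> : embed_fst_L2 j p = \pi_E (MkL2fun h).
  by congr (\pi_E _); apply/val_inj; rewrite /= insubdK.
exact: repr_piE.
Qed.

Lemma embed_fst_L2_dist j p q (e : R) : continuous p -> continuous q ->
  0 <= e -> (forall x, I x -> `|p x - q x| <= e) ->
  `|embed_fst_L2 j p - embed_fst_L2 j q| <= e%:C.
Proof.
move=> cp cq e0 he; rewrite L2_normE lecR -(ger0_norm e0) -sqrtr_sqr ler_wsqrtr//.
have cpq : continuous (p \- q) by move=> x; apply: cvgB; [exact: cp|exact: cq].
have hpq := square_integrable_embed_fst j cpq.
have ae : L2_fun (embed_fst_L2 j p - embed_fst_L2 j q) =
    embed_fst j (p \- q) %[ae leb2 R in S].
  rewrite -scaleN1r.
  have := ae_square_sym (L2_funD (embed_fst_L2 j p) (-1 *: embed_fst_L2 j q)).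
  move=> /ae_square_trans; apply.
  apply: (@ae_square_trans _ _ _ (embed_fst j p + -1 *: embed_fst j q)).
    apply: ae_eqD; first exact: embed_fst_L2_ae.
    apply: ae_square_trans (ae_square_sym (L2_funZ _ _)) _.
    by apply: ae_eqZ; exact: embed_fst_L2_ae.
  apply/aeW => k _; rewrite !fctE /embed_fst scaleN1r -scalerBl.
  by rewrite raddfB.
rewrite (sqint_ae (L2_funS _) hpq ae) /sqint.
have -> : e ^+ 2 = \int[leb2 R]_(k in S) (e ^+ 2).
  by rewrite Rintegral_cst// [X in fine X]leb2_unit_square mulr1.
apply: le_Rintegral => //.
- by have /square_integrableP[] := hpq.
- exact: integrable_cst_square.
- move=> k [k1 _]; rewrite sqnorm_embed_fst/= -real_normK ?num_real//.
  by rewrite ler_pXn2r ?nnegrE// he.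
Qed.

(** On a set of continuous functions the embedding is continuous for locally
    uniform convergence: on the square a uniform bound e gives the bound e in
    L2. *)
Lemma compact_embed_kernel j (a : R * R -> R) (C c : R) : continuous a -> 0 <= c ->
  compact (embed_fst_L2 j @` (kernel_modulus a C c)).
Proof.
move=> ca c0.
apply: (@continuous_compact {family compact, R -> R} E (embed_fst_L2 j)); last first.
  exact: kernel_modulus_compact.
apply/subspace_continuousP => f Wf.
apply/(@cvgrPdist_lt _ E) => -[e e'].
rewrite ltcE/= => /andP[/eqP -> e0].
have e20 : 0 < e / 2 by rewrite divr_gt0.
have cI : compact I by exact: segment_compact.
have entd : entourage [set uv : R * R | ball uv.1 (e / 2) uv.2].
  exact: entourage_ball (PosNum e20).
have := fam_nbhs (f : {family compact, R -> R}) entd cI.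
apply: filterS => g h Wg.
apply: (@le_lt_trans _ _ (e / 2)%:C); last first.
  by rewrite ltcR ltr_pdivrMr// ltr_pMr// ltr1n.
apply: embed_fst_L2_dist.
- exact: kernel_modulus_continuous Wf.
- exact: kernel_modulus_continuous Wg.
- exact: ltW.
- by move=> x Ix; have := h x Ix; rewrite /= -ball_normE/= => /ltW.
Qed.
End KernelCompact.

(** * Products of averages and multiplications *)
Section CompositeAverages.
Context (R : realType) (m : nat).
Local Notation I := (@unit_itv R).
Local Notation S := (@unit_square R).
Local Notation mu := (@lebesgue_measure R).
Local Notation E := (L2 R m).
Local Notation vfun := (R * R -> 'cV[R[i]]_m).
Implicit Types (u v : E) (f g : R * R -> 'cV[R[i]]_m) (A B : R * R -> 'M[R[i]]_m).
Let mI : measurable (I : set (measurableTypeR R)) := @measurable_unit_itv R.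
Let mS : measurable (S : set (measurable_plane R)) := @measurable_unit_square R.

Definition mul_op A : E -> E := L2_op (mulmap A).
Definition swap_op : E -> E := L2_op (@swapmap R m).
Definition avg2_op : E -> E := L2_op (@avg2 R m).

Lemma mul_op_bounded A : continuous_mx A -> bounded_op (mul_op A).
Proof. by move=> cA; apply: L2_op_bounded; exact: L2_map_mul. Qed.

Lemma swap_op_bounded : bounded_op swap_op.
Proof. by apply: L2_op_bounded; exact: L2_map_swap. Qed.

Lemma avg2_op_bounded : bounded_op avg2_op.
Proof. by apply: L2_op_bounded; exact: L2_map_avg2. Qed.

Lemma mul_op_acts A : continuous_mx A -> acts_as (mul_op A) (mulmap A).
Proof. by move=> cA; apply: L2_op_acts; exact: L2_map_mul. Qed.

Lemma swap_op_acts : acts_as swap_op (@swapmap R m).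
Proof. by apply: L2_op_acts; exact: L2_map_swap. Qed.

Lemma avg2_op_acts : acts_as avg2_op (@avg2 R m).
Proof. by apply: L2_op_acts; exact: L2_map_avg2. Qed.

Lemma acts_as_eq (T1 T2 : E -> E) (F1 F2 : vfun -> vfun) :
  acts_as T1 F1 -> acts_as T2 F2 ->
  (forall f, f \in square_integrable -> forall k, S k -> F1 f k = F2 f k) ->
  T1 = T2.
Proof.
move=> h1 h2 h; apply: (acts_as_unique (F := fun u => F2 u)) => //.
by apply: (acts_as_ae h1) => f fS; apply/aeW => k; exact: h.
Qed.

Lemma mul_opM A B : continuous_mx A -> continuous_mx B ->
  continuous_mx (fun k => A k *m B k) ->
  mul_op A \o mul_op B = mul_op (fun k => A k *m B k).
Proof.
move=> cA cB cAB.
have := acts_as_comp (L2_map_mul cA) (L2_map_mul cB) (mul_op_acts cA) (mul_op_acts cB).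
move=> /acts_as_eq; apply; first exact: mul_op_acts.
by move=> f _ k _; rewrite /mulmap/= mulmxA.
Qed.

Lemma continuous_mx_swap A : continuous_mx A -> continuous_mx (A \o swap).
Proof.
move=> /subspace_continuousP cA; apply/subspace_continuousP => k Sk.
have Sk' := swap_unit_square Sk.
apply: (@cvg_comp _ _ _ swap A (within S (nbhs k)) (within S (nbhs (swap k))) _ _ (cA _ Sk')).
move=> P hP; change (nbhs k [set y | S y -> P (swap y)]).
have H : nbhs k (swap @^-1` [set y | S y -> P y]).
  apply: (cvg_pair (@cvg_snd _ _ (nbhs k.1) (nbhs k.2) _)
    (@cvg_fst _ _ (nbhs k.1) (nbhs k.2) _)); exact: hP.
by apply: filterS H => y h /swap_unit_square.
Qed.

Lemma avg2_mul_avg2_op A : continuous_mx A ->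
  avg2_op \o mul_op A \o avg2_op = mul_op (mxavg2 A) \o avg2_op.
Proof.
move=> cA; have cA' := continuous_mxavg2 cA.
have av := @L2_map_avg2 R m; have aav := avg2_op_acts.
have mA := L2_map_mul cA; have aA := mul_op_acts cA.
have h1 := acts_as_comp (L2_map_comp av mA) av (acts_as_comp av mA aav aA) aav.
have h2 := acts_as_comp (L2_map_mul cA') av (mul_op_acts cA') aav.
apply: (acts_as_eq h1 h2) => f _ k Sk /=; exact: avg2_mul_avg2.
Qed.

Definition scalar_entry_mx (r : R * R -> R) (j l : 'I_m) : R * R -> 'M[R[i]]_m :=
  fun k => (r k)%:C *: delta_mx j l.

Lemma continuous_scalar_entry_mx (r : R * R -> R) j l : {within S, continuous r} ->
  continuous_mx (scalar_entry_mx r j l).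
Proof.
move=> cr; apply/continuous_mxP => i' l'.
have e0 : {within S, continuous (fun _ : R * R => 0 : R)}.
  by apply: continuous_subspaceT => k; exact: cvg_cst.
have e k : scalar_entry_mx r j l k i' l' =
    if (i' == j) && (l' == l) then (r k)%:C else 0.
  by rewrite /scalar_entry_mx !mxE; case: ifP; rewrite ?mulr1 ?mulr0.
split.
- rewrite (_ : (fun k => _) = (fun k =>
    if (i' == j) && (l' == l) then r k else 0)).
    by case: ((i' == j) && (l' == l)).
  by apply/funext => k; rewrite e; case: ifP.
- rewrite (_ : (fun k => _) = (fun=> 0))//.
  by apply/funext => k; rewrite e; case: ifP.
Qed.

(** P2 M_A J P2, to which both P2 M_A P1 and P1 M_A P2 reduce. *)
Definition cross_map A : vfun -> vfun :=
  @avg2 R m \o mulmap A \o @swapmap R m \o @avg2 R m.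
Definition cross_op A : E -> E := avg2_op \o mul_op A \o swap_op \o avg2_op.

Lemma cross_op_acts A : continuous_mx A -> acts_as (cross_op A) (cross_map A).
Proof.
move=> cA; have av := @L2_map_avg2 R m; have aav := avg2_op_acts.
have mA := L2_map_mul cA; have aA := mul_op_acts cA.
have sw := @L2_map_swap R m; have asw := swap_op_acts.
apply: acts_as_comp => //; first by apply: L2_map_comp => //; exact: L2_map_comp.
apply: acts_as_comp => //; first exact: L2_map_comp.
exact: acts_as_comp.
Qed.

Lemma L2_map_cross A : continuous_mx A -> L2_map (cross_map A).
Proof.
move=> cA; have av := @L2_map_avg2 R m; have mA := L2_map_mul cA.
exact: (L2_map_comp (L2_map_comp (L2_map_comp av mA) (@L2_map_swap R m)) av).
Qed.

Lemma cross_op_linear A : continuous_mx A -> linear (cross_op A).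
Proof.
move=> cA; have cb := @bounded_op_comp R m.
apply: bounded_op_linear; apply: (cb _ _ _ avg2_op_bounded).
apply: (cb _ _ _ swap_op_bounded); apply: (cb _ _ avg2_op_bounded).
exact: mul_op_bounded.
Qed.

(** The average is a function of its first variable only, so its integral over
    the square is one over the interval; |p| <= 1 + p^2 then bounds the
    integral of |p| by 1 + 1. *)
Lemma avg2_integral_le u l : `|u| <= 1 ->
  (mu.-integrable I (EFin \o (fun t => complex.Re (avg2 u (t, 0) l 0))) /\
   \int[mu]_(t in I) `|complex.Re (avg2 u (t, 0) l 0)| <= 2) /\
  (mu.-integrable I (EFin \o (fun t => complex.Im (avg2 u (t, 0) l 0))) /\
   \int[mu]_(t in I) `|complex.Im (avg2 u (t, 0) l 0)| <= 2).
Proof.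
move=> u1; have /square_integrableP[mu_ _] := L2_funS u.
have [avS avle] := square_integrable_avg2 (L2_funS u).
have mav := measurable_avg2_vec mu_.
have s1 : sqint (avg2 u) <= 1.
  apply: le_trans avle _; move: u1; rewrite L2_normE lecR.
  rewrite -[X in _ <= X]sqrtr1 => h; rewrite -[leLHS]sqr_sqrtr ?sqint_ge0//.
  by rewrite -[leRHS](expr1n _ 2) ler_pXn2r ?nnegrE ?sqrtr_ge0// -sqrtr1.
have I0 : I 0 by rewrite unit_itvE lexx ler01.
have mq : measurable_fun (I : set (measurableTypeR R)) (fun t => sqnorm (avg2 u (t, 0))).
  have := measurable_fun_swap (measurable_sqnorm mav).
  by move=> /(measurable_slice I0).
have sE : (\int[leb2 R]_(k in S) (sqnorm (avg2 u k))%:E =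
    \int[mu]_(t in I) (sqnorm (avg2 u (t, 0)))%:E)%E.
  rewrite tonelli_unit; first last.
  - by move=> k Sk; rewrite lee_fin sqnorm_ge0.
  - by apply/measurable_EFinP; exact: measurable_sqnorm.
  by apply: eq_integral => t _; rewrite -[RHS]integral_const_itv.
have iq : mu.-integrable I (EFin \o (fun t => sqnorm (avg2 u (t, 0)))).
  have /square_integrableP[_ avi] := avS.
  apply/integrableP; split; first exact/measurable_EFinP.
  under eq_integral do rewrite abse_EFin ger0_norm ?sqnorm_ge0//.
  rewrite -sE; have := integrable_fin_num mS avi.
  by rewrite fin_numE ltey => /andP[].
have q1 : \int[mu]_(t in I) sqnorm (avg2 u (t, 0)) <= 1.
  by rewrite /Rintegral -sE.
have key (p : R -> R) : measurable_fun (I : set (measurableTypeR R)) p ->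
    (forall t, p t ^+ 2 <= sqnorm (avg2 u (t, 0))) ->
    mu.-integrable I (EFin \o p) /\ \int[mu]_(t in I) `|p t| <= 2.
  move=> mp hp.
  have i1q : mu.-integrable I (EFin \o (fun t => 1 + sqnorm (avg2 u (t, 0)))).
    exact: (integrableD mI (integrable_cst_itv 1) iq).
  have hp1 t : `|p t| <= 1 + sqnorm (avg2 u (t, 0)).
    apply: le_trans (_ : 1 + p t ^+ 2 <= _); last by rewrite lerD2l.
    rewrite -(real_normK (num_real (p t))) -subr_ge0.
    rewrite (_ : _ - _ = (`|p t| - 2^-1) ^+ 2 + 3 / 4); last by field.
    by rewrite addr_ge0 ?sqr_ge0// divr_ge0.
  have ip : mu.-integrable I (EFin \o p).
    apply: (le_integrable mI _ _ i1q); first exact/measurable_EFinP.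
    by move=> t _; rewrite !abse_EFin lee_fin (le_trans (hp1 t))// ler_norm.
  split => //.
  apply: (@le_trans _ _ (\int[mu]_(t in I) (1 + sqnorm (avg2 u (t, 0))))).
    by apply: le_Rintegral => //; exact: integrable_norm.
  rewrite RintegralD//; last exact: integrable_cst_itv.
  by rewrite Rintegral_cst_itv (_ : 2 = 1 + 1 :> R)// lerD2l.
have mre := measurable_vec_slice I0
  (f := swapmap (avg2 u)) _ l.
have [|mr mi] := mre.
  by move=> j; have [a b] := mav j; split;
    [exact: (measurable_fun_swap a)|exact: (measurable_fun_swap b)].
by split; apply: key => // t; have [] := sqr_entry_le_sqnorm (avg2 u (t, 0)) l.
Qed.

(** Only the j-th entry of the result is nonzero.  Its real and imaginary parts
    are the integrals of the kernel r against the real and imaginary parts of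
    the l-th entry of the average of u, so the unit ball is mapped into the sum
    of a compact set and of its multiple by i. *)
Lemma cross_op_entry_compact (r : R * R -> R) j l : {within S, continuous r} ->
  compact_op (cross_op (scalar_entry_mx r j l)).
Proof.
move=> cr; have cA := @continuous_scalar_entry_mx r j l cr.
have ca := continuous_extend cr; set a := r \o @clamp_square R in ca.
have [C C0 hC] := bounded_on_square cr.
pose W : set (R -> R) := kernel_modulus a (C * 2) 2.
have cK := @compact_embed_kernel R m j a (C * 2) 2 ca (ler0n R 2).
pose K : set E := (fun x : E * E => x.1 + x.2) @`
  ((embed_fst_L2 j @` W) `*` ((fun u => 'i *: u) @` (embed_fst_L2 j @` W))).
have cK2 : compact K.
  apply: continuous_compact.
    by apply: continuous_subspaceT; exact: add_continuous.
  apply: compact_setX => //; apply: continuous_compact => //.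
  apply: continuous_subspaceT.
  exact: (bounded_op_continuous (bounded_opZ 'i (@bounded_op_id R m))).
apply: (compact_op_intro (cross_op_linear cA) cK2) => u u1.
have [[ip p2] [iq q2]] := avg2_integral_le l u1.
set p := fun t => complex.Re (avg2 u (t, 0) l 0) in ip p2.
set q := fun t => complex.Im (avg2 u (t, 0) l 0) in iq q2.
have aC k : `|a k| <= C by apply: hC; exact: clamp_squareP.
have Wp := kernel_integral_modulus ca C0 aC ip p2.
have Wq := kernel_integral_modulus ca C0 aC iq q2.
set P := (fun x => _) in Wp; set Q := (fun x => _) in Wq.
have cP := kernel_modulus_continuous ca (ler0n R 2) Wp.
have cQ := kernel_modulus_continuous ca (ler0n R 2) Wq.
exists (embed_fst_L2 j P, 'i *: embed_fst_L2 j Q).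
  split; first by exists P.
  by exists (embed_fst_L2 j Q) => //; exists Q.
apply: L2_eq_ae; apply/ae_square_sym; apply: ae_square_trans (cross_op_acts cA u) _.
apply: ae_square_trans (L2_funD _ _).
apply: (@ae_square_trans _ _ _ (embed_fst j P + 'i *: embed_fst j Q)); last first.
  apply: ae_eqD; first exact/ae_square_sym/embed_fst_L2_ae.
  by apply: ae_square_trans (L2_funZ _ _); apply: ae_eqZ; exact/ae_square_sym/embed_fst_L2_ae.
apply/aeW => -[x y] [/= Ix Iy]; apply/colP => i0; rewrite !fctE !mxE.
transitivity (cintegral (fun t => (i0 == j)%:R * ((r (x, t))%:C * avg2 u (t, 0) l 0))).
  apply: eq_cintegral => t _; rewrite /mulmap mxE (bigD1 l)//= big1.
    rewrite addr0 /scalar_entry_mx !mxE eqxx andbT /=.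
    by rewrite mulrAC mulrC mulrA.
  by move=> l' ll'; rewrite /scalar_entry_mx !mxE (negbTE ll') andbF mulr0 mul0r.
rewrite !andbT; case: (i0 == j); last first.
  by rewrite !mulr0 addr0; under eq_cintegral do rewrite mul0r; rewrite cintegral0.
rewrite !mulr1; under eq_cintegral do rewrite mul1r.
have rE t : I t -> r (x, t) = a (x, t) by move=> It; rewrite /a/= clamp_square_id.
apply: eq_complexP.
- rewrite raddfD/= !(mul0r, mulr0, mul1r, subr0, addr0) /P.
  apply: eq_Rintegral => t /set_mem It.
  by rewrite complex_ReM/= mul0r subr0 rE.
- rewrite raddfD/= !(mul0r, mulr0, mul1r, add0r, addr0) /Q.
  apply: eq_Rintegral => t /set_mem It.
  by rewrite complex_ImM/= mul0r addr0 rE.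
Qed.
End CompositeAverages.

(** * Algebra of continuous matrix functions *)
Section ContinuousMatrices.
Context (R : realType).
Local Notation S := (@unit_square R).

Lemma continuous_mx_cst p q (A : 'M[R[i]]_(p, q)) : continuous_mx (fun=> A).
Proof. by apply: continuous_subspaceT => k; exact: cvg_cst. Qed.

Lemma continuous_mxD p q (A B : R * R -> 'M[R[i]]_(p, q)) :
  continuous_mx A -> continuous_mx B -> continuous_mx (fun k => A k + B k).
Proof.
move=> /continuous_mxP cA /continuous_mxP cB; apply/continuous_mxP => i j.
have [ar ai] := cA i j; have [br bi] := cB i j; split.
- under eq_fun do rewrite mxE raddfD/=.
  by move=> x; apply: (@continuousD R R (subspace S)); [exact: ar|exact: br].
- under eq_fun do rewrite mxE raddfD/=.
  by move=> x; apply: (@continuousD R R (subspace S)); [exact: ai|exact: bi].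
Qed.

Lemma continuous_within_sum n (f : 'I_n -> R * R -> R) :
  (forall l, {within S, continuous (f l)}) ->
  {within S, continuous (fun k => \sum_(l < n) f l k)}.
Proof.
move=> cf; elim: (index_enum _) => [|l s IHs].
  under eq_fun do rewrite big_nil.
  by apply: continuous_subspaceT => k; exact: cvg_cst.
under eq_fun do rewrite big_cons.
by move=> x; apply: (@continuousD R R (subspace S)); [exact: cf|exact: IHs].
Qed.

Lemma continuous_mxM p q r (A : R * R -> 'M[R[i]]_(p, q)) (B : R * R -> 'M[R[i]]_(q, r)) :
  continuous_mx A -> continuous_mx B -> continuous_mx (fun k => A k *m B k).
Proof.
move=> /continuous_mxP cA /continuous_mxP cB; apply/continuous_mxP => i j; split.
- rewrite (_ : (fun k => _) = (fun k => \sum_(l < q)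
    (complex.Re (A k i l) * complex.Re (B k l j) -
     complex.Im (A k i l) * complex.Im (B k l j)))); last first.
    apply/funext => k; rewrite mxE raddf_sum/=.
    by apply: eq_bigr => l _; rewrite complex_ReM.
  apply: continuous_within_sum => l x.
  have [ar ai] := cA i l; have [br bi] := cB l j.
  by apply: (@continuousB R R (subspace S)); apply: (@continuousM R (subspace S));
    [exact: ar|exact: br|exact: ai|exact: bi].
- rewrite (_ : (fun k => _) = (fun k => \sum_(l < q)
    (complex.Re (A k i l) * complex.Im (B k l j) +
     complex.Im (A k i l) * complex.Re (B k l j)))); last first.
    apply/funext => k; rewrite mxE raddf_sum/=.
    by apply: eq_bigr => l _; rewrite complex_ImM.
  apply: continuous_within_sum => l x.
  have [ar ai] := cA i l; have [br bi] := cB l j.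
  by apply: (@continuousD R R (subspace S)); apply: (@continuousM R (subspace S));
    [exact: ar|exact: bi|exact: ai|exact: br].
Qed.

Lemma continuous_row_mx p q r (A : R * R -> 'M[R[i]]_(p, q))
    (B : R * R -> 'M[R[i]]_(p, r)) :
  continuous_mx A -> continuous_mx B -> continuous_mx (fun k => row_mx (A k) (B k)).
Proof.
move=> /continuous_mxP cA /continuous_mxP cB; apply/continuous_mxP => i j.
case: (splitP j) => l jl.
- have e k : row_mx (A k) (B k) i j = A k i l.
    by rewrite (_ : j = lshift r l) ?row_mxEl//; exact: val_inj.
  by under eq_fun do rewrite e; under [X in _ /\ {within _, continuous X}]eq_fun do rewrite e.
- have e k : row_mx (A k) (B k) i j = B k i l.
    by rewrite (_ : j = rshift q l) ?row_mxEr//; exact: val_inj.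
  by under eq_fun do rewrite e; under [X in _ /\ {within _, continuous X}]eq_fun do rewrite e.
Qed.

Lemma continuous_col_mx p q r (A : R * R -> 'M[R[i]]_(q, p))
    (B : R * R -> 'M[R[i]]_(r, p)) :
  continuous_mx A -> continuous_mx B -> continuous_mx (fun k => col_mx (A k) (B k)).
Proof.
move=> /continuous_mxP cA /continuous_mxP cB; apply/continuous_mxP => i j.
case: (splitP i) => l jl.
- have e k : col_mx (A k) (B k) i j = A k l j.
    by rewrite (_ : i = lshift r l) ?col_mxEu//; exact: val_inj.
  by under eq_fun do rewrite e; under [X in _ /\ {within _, continuous X}]eq_fun do rewrite e.
- have e k : col_mx (A k) (B k) i j = B k l j.
    by rewrite (_ : i = rshift q l) ?col_mxEd//; exact: val_inj.
  by under eq_fun do rewrite e; under [X in _ /\ {within _, continuous X}]eq_fun do rewrite e.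
Qed.

Lemma avg2_col_mx p q (f : R * R -> 'cV[R[i]]_p) (g : R * R -> 'cV[R[i]]_q) k :
  avg2 (fun k => col_mx (f k) (g k)) k = col_mx (avg2 f k) (avg2 g k).
Proof.
apply/colP => i; rewrite !mxE; case: (splitP i) => l il; rewrite mxE.
- apply: eq_cintegral => t _.
  by rewrite (_ : i = lshift q l) ?col_mxEu//; exact: val_inj.
- apply: eq_cintegral => t _.
  by rewrite (_ : i = rshift p l) ?col_mxEd//; exact: val_inj.
Qed.

Lemma avg1_col_mx p q (f : R * R -> 'cV[R[i]]_p) (g : R * R -> 'cV[R[i]]_q) k :
  avg1 (fun k => col_mx (f k) (g k)) k = col_mx (avg1 f k) (avg1 g k).
Proof. exact: (avg2_col_mx (f \o swap) (g \o swap) (swap k)). Qed.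

Lemma avg2_delta p q (i : 'I_p) (j : 'I_q) (f : R * R -> 'cV[R[i]]_q) k :
  avg2 (fun k => delta_mx i j *m f k) k = delta_mx i j *m avg2 f k.
Proof.
have e (v : 'cV[R[i]]_q) i' : (delta_mx i j *m v) i' 0 = (i' == i)%:R * v j 0.
  rewrite mxE (bigD1 j)//= big1 => [|l lj]; first by rewrite addr0 mxE eqxx andbT.
  by rewrite mxE (negbTE lj) andbF mul0r.
apply/colP => i'; rewrite e !mxE; under eq_cintegral do rewrite e.
case: (i' == i); first by rewrite mul1r; under eq_cintegral do rewrite mul1r.
by rewrite mul0r; under eq_cintegral do rewrite mul0r; exact: cintegral0.
Qed.

Lemma avg1_delta p q (i : 'I_p) (j : 'I_q) (f : R * R -> 'cV[R[i]]_q) k :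
  avg1 (fun k => delta_mx i j *m f k) k = delta_mx i j *m avg1 f k.
Proof. exact: (avg2_delta i j (f \o swap) (swap k)). Qed.

(** Each summand is the j-th column of A times the j-th entry of v, written as
    a product through the coordinate i0 of a space of another dimension. *)
Lemma sum_delta_sandwich p q r (i0 : 'I_r) (A : 'M[R[i]]_(p, q)) (v : 'cV[R[i]]_q) :
  \sum_(j < q) (A *m delta_mx j i0) *m (delta_mx i0 j *m v) = A *m v.
Proof.
transitivity (\sum_(j < q) A *m delta_mx j j *m v).
  by apply: eq_bigr => j _; rewrite mulmxA -(mulmxA A) mul_delta_mx.
by rewrite -mulmx_suml -mulmx_sumr -mx1_sum_delta mulmx1.
Qed.
End ContinuousMatrices.

(** * Finite sums of elementary operators *)
Section DefectAlgebra.
Context (R : realType) (m : nat).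
Local Notation S := (@unit_square R).
Local Notation E := (L2 R m).
Local Notation vfun := (R * R -> 'cV[R[i]]_m).
Implicit Types (u v : E) (T K : E -> E) (A B : R * R -> 'M[R[i]]_m).

(** Reduces compactness for a matrix of complex functions to a single real
    entry. *)
Lemma mul_op_decomposition A : continuous_mx A ->
  mul_op A = (fun u => \sum_(j < m) \sum_(l < m)
    (mul_op (scalar_entry_mx (fun k => complex.Re (A k j l)) j l) u +
     'i *: mul_op (scalar_entry_mx (fun k => complex.Im (A k j l)) j l) u)).
Proof.
move=> /[dup] cA /continuous_mxP cAe.
have act j l : acts_as (fun u =>
    mul_op (scalar_entry_mx (fun k => complex.Re (A k j l)) j l) u +
    'i *: mul_op (scalar_entry_mx (fun k => complex.Im (A k j l)) j l) u)
  (fun u k => mulmap (scalar_entry_mx (fun k => complex.Re (A k j l)) j l) u k +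
    'i *: mulmap (scalar_entry_mx (fun k => complex.Im (A k j l)) j l) u k).
  have [cr ci] := cAe j l; apply: acts_asD.
    by apply: mul_op_acts; exact: continuous_scalar_entry_mx.
  by apply: acts_asZ; apply: mul_op_acts; exact: continuous_scalar_entry_mx.
have act2 := acts_as_sum (fun j => acts_as_sum (act j)).
apply: (acts_as_unique (mul_op_acts cA)) => u; apply: ae_square_trans (act2 u) _.
apply/aeW => k _; rewrite /mulmap [in RHS](matrix_sum_delta (A k)) mulmx_suml.
apply: eq_bigr => j _; rewrite mulmx_suml; apply: eq_bigr => l _.
rewrite [in RHS](complexE (A k j l)) scalerDl mulmxDl -scalerA.
by rewrite -(scalemxAl 'i).
Qed.

Lemma cross_op_compact A : continuous_mx A -> compact_op (cross_op A).
Proof.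
move=> /[dup] cA /continuous_mxP cAe.
pose Tr j l := cross_op (scalar_entry_mx (fun k => complex.Re (A k j l)) j l).
pose Ti j l := cross_op (scalar_entry_mx (fun k => complex.Im (A k j l)) j l).
have -> : cross_op A = (fun u => \sum_(j < m) \sum_(l < m) (Tr j l u + 'i *: Ti j l u)).
  apply/funext => u; rewrite /cross_op /= mul_op_decomposition//.
  have lin := bounded_op_linear (@avg2_op_bounded R m).
  rewrite linear_op_sum//; apply: eq_bigr => j _.
  rewrite linear_op_sum//; apply: eq_bigr => l _.
  by rewrite linear_opD// linear_opZ.
apply: compact_op_sum => j; apply: compact_op_sum => l; have [cr ci] := cAe j l.
by apply: compact_opD; [|apply: compact_opZ]; exact: cross_op_entry_compact.
Qed.

Definition avg1_op : E -> E := L2_op (@avg1 R m).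

Lemma L2_map_avg1 : L2_map (@avg1 R m).
Proof.
have sw := @L2_map_swap R m.
exact: (L2_map_comp sw (L2_map_comp (@L2_map_avg2 R m) sw)).
Qed.

Lemma avg1_op_bounded : bounded_op avg1_op.
Proof. exact: (L2_op_bounded L2_map_avg1). Qed.

Lemma avg1_op_acts : acts_as avg1_op (@avg1 R m).
Proof. exact: (L2_op_acts L2_map_avg1). Qed.

Local Opaque mul_op swap_op avg2_op avg1_op.

Lemma mul_acts_comp A T (F : vfun -> vfun) : continuous_mx A -> L2_map F ->
  acts_as T F -> acts_as (mul_op A \o T) (mulmap A \o F).
Proof. by move=> cA mF aF; exact: (acts_as_comp (L2_map_mul cA) mF (mul_op_acts cA) aF). Qed.

(** The identity for the second variable, conjugated by the exchange of
    variables. *)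
Lemma avg1_mul_avg1_op A : continuous_mx A ->
  avg1_op \o mul_op A \o avg1_op = mul_op (mxavg2 (A \o swap) \o swap) \o avg1_op.
Proof.
move=> cA; have cA' := continuous_mx_swap cA.
have cA2 := continuous_mx_swap (continuous_mxavg2 cA').
have av := L2_map_avg1; have aav := avg1_op_acts.
have mA := L2_map_mul cA; have aA := mul_op_acts cA.
have h1 := acts_as_comp (L2_map_comp av mA) av (acts_as_comp av mA aav aA) aav.
have h2 := mul_acts_comp cA2 av aav.
apply: (acts_as_eq h1 h2) => f _ k /swap_unit_square Sk.
exact: (avg2_mul_avg2 (swapmap f) cA' Sk).
Qed.

(** Here P1 = J P2 J and J M_A = M_B J, where B is A with exchanged
    variables. *)
Lemma avg1_mul_avg2_op A : continuous_mx A ->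
  avg1_op \o mul_op A \o @avg2_op R m = @swap_op R m \o cross_op (A \o swap).
Proof.
move=> cA; have cA' := continuous_mx_swap cA.
have av := @L2_map_avg2 R m; have aav := @avg2_op_acts R m.
have av1 := L2_map_avg1; have aav1 := avg1_op_acts.
have mA := L2_map_mul cA; have aA := mul_op_acts cA.
have sw := @L2_map_swap R m; have asw := @swap_op_acts R m.
have h1 := acts_as_comp (L2_map_comp av1 mA) av (acts_as_comp av1 mA aav1 aA) aav.
have mX := L2_map_cross cA'.
have h2 := acts_as_comp sw mX asw (cross_op_acts cA').
by apply: (acts_as_eq h1 h2).
Qed.

Lemma avg2_mul_avg1_op A : continuous_mx A ->
  @avg2_op R m \o mul_op A \o avg1_op = cross_op A \o @swap_op R m.
Proof.
move=> cA.
have av := @L2_map_avg2 R m; have aav := @avg2_op_acts R m.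
have av1 := L2_map_avg1; have aav1 := avg1_op_acts.
have mA := L2_map_mul cA; have aA := mul_op_acts cA.
have sw := @L2_map_swap R m; have asw := @swap_op_acts R m.
have h1 := acts_as_comp (L2_map_comp av mA) av1 (acts_as_comp av mA aav aA) aav1.
have mX := L2_map_cross cA.
have h2 := acts_as_comp mX sw (cross_op_acts cA) asw.
by apply: (acts_as_eq h1 h2).
Qed.

Inductive elementary_op : (E -> E) -> Prop :=
| elementary_mul A : continuous_mx A -> elementary_op (mul_op A)
| elementary_avg1 A B : continuous_mx A -> continuous_mx B ->
    elementary_op (mul_op A \o avg1_op \o mul_op B)
| elementary_avg2 A B : continuous_mx A -> continuous_mx B ->
    elementary_op (mul_op A \o @avg2_op R m \o mul_op B)
| elementary_compact K : compact_op K -> elementary_op K.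

Lemma elementary_op_bounded T : elementary_op T -> bounded_op T.
Proof.
have cb := @bounded_op_comp R m; have mb := @mul_op_bounded R m.
case=> [A cA|A B cA cB|A B cA cB|K cK].
- exact: mb.
- by apply: (cb _ _ _ (mb _ cB)); apply: (cb _ _ (mb _ cA)); exact: avg1_op_bounded.
- by apply: (cb _ _ _ (mb _ cB)); apply: (cb _ _ (mb _ cA)); exact: avg2_op_bounded.
- exact: compact_op_bounded.
Qed.

Lemma mul_op_mulE A B u : continuous_mx A -> continuous_mx B ->
  mul_op A (mul_op B u) = mul_op (fun k => A k *m B k) u.
Proof.
move=> cA cB.
by rewrite -(mul_opM cA cB (continuous_mxM cA cB)).
Qed.

(** In each product of two elementary operators the two inner multiplications
    merge.  What remains is absorbed by [avg2_mul_avg2_op] or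
    [avg1_mul_avg1_op] when the averages are over the same variable, is compact
    by [cross_op_compact] when they are not, and is compact by the ideal
    property when one factor is. *)
Lemma elementary_op_comp T1 T2 : elementary_op T1 -> elementary_op T2 ->
  elementary_op (T1 \o T2).
Proof.
move=> e1 e2.
have mb := @mul_op_bounded R m.
have cK1 A B K : continuous_mx A -> continuous_mx B -> compact_op K ->
    compact_op (mul_op A \o K \o mul_op B).
  move=> cA cB cK; apply: compact_bounded_op (mb _ cB) _.
  exact: bounded_compact_op (mb _ cA) cK.
have swb := @swap_op_bounded R m.
case: e2 => [B cB|B B' cB cB'|B B' cB cB'|K cK]; last first.
- exact: (elementary_compact (bounded_compact_op (elementary_op_bounded e1) cK)).
- case: e1 => [A cA|A A' cA cA'|A A' cA cA'|K cK]; last first.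
  + exact: (elementary_compact (compact_bounded_op
      (elementary_op_bounded (elementary_avg2 cB cB')) cK)).
  + have cC := continuous_mxM cA' cB.
    rewrite (_ : _ \o _ = mul_op (fun k => A k *m mxavg2 (fun k => A' k *m B k) k) \o
        @avg2_op R m \o mul_op B'); last first.
      apply/funext => u /=; rewrite (mul_op_mulE _ cA' cB).
      rewrite -(mul_op_mulE _ cA (continuous_mxavg2 cC)).
      exact: (congr1 (fun T => mul_op A (T (mul_op B' u))) (avg2_mul_avg2_op cC)).
    exact: (elementary_avg2 (continuous_mxM cA (continuous_mxavg2 cC)) cB').
  + have cC := continuous_mxM cA' cB.
    apply: elementary_compact.
    rewrite (_ : _ \o _ = mul_op A \o (@swap_op R m \o
        cross_op ((fun k => A' k *m B k) \o swap)) \o mul_op B'); last first.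
      apply/funext => u /=; rewrite (mul_op_mulE _ cA' cB).
      exact: (congr1 (fun T => mul_op A (T (mul_op B' u))) (avg1_mul_avg2_op cC)).
    apply: (cK1 _ _ _ cA cB'); apply: (bounded_compact_op swb).
    exact: (cross_op_compact (continuous_mx_swap cC)).
  + rewrite (_ : _ \o _ = mul_op (fun k => A k *m B k) \o @avg2_op R m \o mul_op B').
      exact: (elementary_avg2 (continuous_mxM cA cB) cB').
    by apply/funext => u /=; rewrite (mul_op_mulE _ cA cB).
- case: e1 => [A cA|A A' cA cA'|A A' cA cA'|K cK]; last first.
  + exact: (elementary_compact (compact_bounded_op
      (elementary_op_bounded (elementary_avg1 cB cB')) cK)).
  + have cC := continuous_mxM cA' cB.
    apply: elementary_compact.
    rewrite (_ : _ \o _ = mul_op A \o (cross_op (fun k => A' k *m B k) \o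
        @swap_op R m) \o mul_op B'); last first.
      apply/funext => u /=; rewrite (mul_op_mulE _ cA' cB).
      exact: (congr1 (fun T => mul_op A (T (mul_op B' u))) (avg2_mul_avg1_op cC)).
    apply: (cK1 _ _ _ cA cB').
    exact: (compact_bounded_op swb (cross_op_compact cC)).
  + have cC := continuous_mxM cA' cB.
    have cD := continuous_mx_swap (continuous_mxavg2 (continuous_mx_swap cC)).
    rewrite (_ : _ \o _ = mul_op (fun k => A k *m
        (mxavg2 ((fun k => A' k *m B k) \o swap) \o swap) k) \o
        avg1_op \o mul_op B'); last first.
      apply/funext => u /=; rewrite (mul_op_mulE _ cA' cB) -(mul_op_mulE _ cA cD).
      exact: (congr1 (fun T => mul_op A (T (mul_op B' u))) (avg1_mul_avg1_op cC)).
    exact: (elementary_avg1 (continuous_mxM cA cD) cB').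
  + rewrite (_ : _ \o _ = mul_op (fun k => A k *m B k) \o avg1_op \o mul_op B').
      exact: (elementary_avg1 (continuous_mxM cA cB) cB').
    by apply/funext => u /=; rewrite (mul_op_mulE _ cA cB).
- case: e1 => [A cA|A A' cA cA'|A A' cA cA'|K cK]; last first.
  + exact: (elementary_compact (compact_bounded_op (mb _ cB) cK)).
  + rewrite (_ : _ \o _ = mul_op A \o @avg2_op R m \o mul_op (fun k => A' k *m B k)).
      exact: (elementary_avg2 cA (continuous_mxM cA' cB)).
    by apply/funext => u /=; rewrite (mul_op_mulE _ cA' cB).
  + rewrite (_ : _ \o _ = mul_op A \o avg1_op \o mul_op (fun k => A' k *m B k)).
      exact: (elementary_avg1 cA (continuous_mxM cA' cB)).
    by apply/funext => u /=; rewrite (mul_op_mulE _ cA' cB).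
  + rewrite (mul_opM cA cB (continuous_mxM cA cB)).
    exact: (elementary_mul (continuous_mxM cA cB)).
Qed.

Inductive elementary_sum : (E -> E) -> Prop :=
| elementary_sum0 : elementary_sum (fun=> 0)
| elementary_sum1 T : elementary_op T -> elementary_sum T
| elementary_sumD T1 T2 : elementary_sum T1 -> elementary_sum T2 ->
    elementary_sum (fun u => T1 u + T2 u).

Lemma elementary_sum_bounded T : elementary_sum T -> bounded_op T.
Proof.
elim=> [|{}T /elementary_op_bounded//|T1 T2 _ b1 _ b2]; first exact: bounded_op0.
exact: bounded_opD.
Qed.

Lemma elementary_sum_comp T1 T2 : elementary_sum T1 -> elementary_sum T2 ->
  elementary_sum (T1 \o T2).
Proof.
move=> e1 e2; elim: e1 => [|{}T1 e1|T T' _ IH _ IH'].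
- exact: elementary_sum0.
- have lT1 := bounded_op_linear (elementary_op_bounded e1).
  elim: e2 => [|{}T2 e2|T T' _ IH _ IH'].
  + rewrite (_ : _ \o _ = fun=> 0); first exact: elementary_sum0.
    by apply/funext => u /=; rewrite linear_op0.
  + by apply: elementary_sum1; exact: elementary_op_comp.
  + rewrite (_ : _ \o _ = fun u => (T1 \o T) u + (T1 \o T') u).
      exact: elementary_sumD.
    by apply/funext => u /=; rewrite linear_opD.
- exact: (elementary_sumD IH IH').
Qed.

(** Makes closure under scalars a case of closure under composition, and the
    averages themselves elementary. *)
Lemma mul_op_scalar (a : R[i]) : mul_op (fun=> a%:M) = (fun u : E => a *: u).
Proof.
have id_acts : acts_as (fun u : E => u) (fun u => L2_fun u) by move=> u; exact: ae_eq_refl.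
have aM := mul_op_acts (@continuous_mx_cst R m m a%:M).
apply: (acts_as_unique aM) => u.
apply: ae_square_trans (acts_asZ a id_acts u) _.
by apply/aeW => k _; rewrite /mulmap mul_scalar_mx.
Qed.

Lemma elementary_sum_subalgebra : subalgebra elementary_sum.
Proof.
split.
- exact: elementary_sum_bounded.
- exact: elementary_sum0.
- exact: elementary_sumD.
- move=> a T eT; have := elementary_sum_comp (elementary_sum1
    (elementary_mul (@continuous_mx_cst R m m a%:M))) eT.
  by rewrite mul_op_scalar.
- exact: elementary_sum_comp.
Qed.

Lemma mul_op1 : mul_op (fun=> 1%:M) = (id : E -> E).
Proof. by rewrite mul_op_scalar; apply/funext => u; rewrite scale1r. Qed.

Lemma defect_algebra_elementary : @defect_algebra R m `<=` elementary_sum.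
Proof.
have c1 := @continuous_mx_cst R m m 1%:M.
apply: smallest_sub; first exact: elementary_sum_subalgebra.
move=> T [[[[A [cA aA]]|a1]|a2]|cK]; apply: elementary_sum1.
- by rewrite (acts_as_unique aA (mul_op_acts cA)); exact: elementary_mul.
- rewrite (acts_as_unique a1 (avg1_op_acts)).
  by have := elementary_avg1 c1 c1; rewrite mul_op1.
- rewrite (acts_as_unique a2 (@avg2_op_acts R m)).
  by have := elementary_avg2 c1 c1; rewrite mul_op1.
- exact: elementary_compact.
Qed.

Lemma elementary_defect_algebra : elementary_sum `<=` @defect_algebra R m.
Proof.
move=> T eT X [[_ X0 XD _ XC] gX].
have Xmul A : continuous_mx A -> X (mul_op A).
  by move=> cA; apply: gX; do 3 left; exists A; split => //; exact: mul_op_acts.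
have X1 : X avg1_op by apply: gX; left; left; right; exact: (avg1_op_acts).
have X2 : X (@avg2_op R m).
  by apply: gX; left; right; exact: (@avg2_op_acts R m).
elim: eT => [|{}T e|T1 T2 _ h1 _ h2] //; last exact: XD.
case: e => [A cA|A B cA cB|A B cA cB|K cK].
- exact: Xmul.
- exact: (XC _ _ (XC _ _ (Xmul _ cA) X1) (Xmul _ cB)).
- exact: (XC _ _ (XC _ _ (Xmul _ cA) X2) (Xmul _ cB)).
- by apply: gX; right.
Qed.

(** Two averaged terms become one by concatenation: the product of a row block
    with a column block is the sum of the products of the blocks. *)
Lemma defect_formD T1 T2 : defect_form T1 -> defect_form T2 ->
  defect_form (fun u => T1 u + T2 u).
Proof.
move=> [M1 [M2 [A0 [A1 [B1 [A2 [B2 [K [[M10 M20] [c0 c1 d1 c2 d2] cK a]]]]]]]]].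
move=> [M1' [M2' [A0' [A1' [B1' [A2' [B2' [K' [[M10' M20'] [c0' c1' d1' c2' d2'] cK' a']]]]]]]]].
exists (M1 + M1')%N, (M2 + M2')%N, (fun k => A0 k + A0' k).
exists (fun k => row_mx (A1 k) (A1' k)), (fun k => col_mx (B1 k) (B1' k)).
exists (fun k => row_mx (A2 k) (A2' k)), (fun k => col_mx (B2 k) (B2' k)).
exists (fun u => K u + K' u); split.
- by rewrite !addn_gt0 M10 M20.
- split; [exact: continuous_mxD|exact: continuous_row_mx|exact: continuous_col_mx|
    exact: continuous_row_mx|exact: continuous_col_mx].
- exact: compact_opD.
- move=> u; apply: ae_square_trans (acts_asD a a' u) _.
  have := L2_funD (K u) (K' u); apply: filterS => k h Sk; rewrite -(h Sk) fctE.
  have -> : avg1 (fun k' => col_mx (B1 k') (B1' k') *m L2_fun u k') k =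
      col_mx (avg1 (fun k' => B1 k' *m L2_fun u k') k)
             (avg1 (fun k' => B1' k' *m L2_fun u k') k).
    rewrite -avg1_col_mx; congr (avg1 _ k).
    by apply/funext => k'; rewrite mul_col_mx.
  have -> : avg2 (fun k' => col_mx (B2 k') (B2' k') *m L2_fun u k') k =
      col_mx (avg2 (fun k' => B2 k' *m L2_fun u k') k)
             (avg2 (fun k' => B2' k' *m L2_fun u k') k).
    rewrite -avg2_col_mx; congr (avg2 _ k).
    by apply/funext => k'; rewrite mul_col_mx.
  rewrite !mul_row_col mulmxDl.
  by rewrite [LHS]addrACA; congr (_ + _); rewrite [LHS]addrACA; congr (_ + _);
    rewrite addrACA.
Qed.

Lemma add_mul0mx p q (x : 'cV[R[i]]_m) (X : 'cV[R[i]]_p) (Y : 'cV[R[i]]_q) :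
  x = x + (0 : 'M[R[i]]_(m, p)) *m X + (0 : 'M[R[i]]_(m, q)) *m Y + 0.
Proof. by rewrite !mul0mx !addr0. Qed.

Lemma mul0mx_add1 p q (x : 'cV[R[i]]_m) (X : 'cV[R[i]]_p) (Y : 'cV[R[i]]_q) :
  x = (0 : 'M[R[i]]_(m, p)) *m X + x + (0 : 'M[R[i]]_(m, q)) *m Y + 0.
Proof. by rewrite !mul0mx !addr0 add0r. Qed.

Lemma mul0mx_add2 p q (x : 'cV[R[i]]_m) (X : 'cV[R[i]]_p) (Y : 'cV[R[i]]_q) :
  x = (0 : 'M[R[i]]_(m, p)) *m X + (0 : 'M[R[i]]_(m, q)) *m Y + x + 0.
Proof. by rewrite !mul0mx !addr0 add0r. Qed.

Lemma mul0mx_add3 p q r (x : 'cV[R[i]]_m) (X : 'cV[R[i]]_p) (Y : 'cV[R[i]]_q)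
    (Z : 'cV[R[i]]_r) :
  x = (0 : 'M[R[i]]_(m, p)) *m X + (0 : 'M[R[i]]_(m, q)) *m Y +
      (0 : 'M[R[i]]_(m, r)) *m Z + x.
Proof. by rewrite !mul0mx !add0r. Qed.

Lemma elementary_op_defect_form T : (0 < m)%N -> elementary_op T -> defect_form T.
Proof.
move=> m0.
have c0 p q : continuous_mx (fun=> 0 : 'M[R[i]]_(p, q)) :=
  @continuous_mx_cst R p q 0.
have k0 := @compact_op0 R m; have a0 := @acts_as0 R m.
case=> [A cA|A B cA cB|A B cA cB|K cK].
- exists 1%N, 1%N, A, (fun=> 0), (fun=> 0), (fun=> 0), (fun=> 0), (fun=> 0).
  split; [by []|split; [exact cA|exact (c0 _ _)..]|exact k0|].
  move=> u; apply: ae_square_trans (mul_op_acts cA u) _.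
  apply: filterS (a0 u) => k h Sk; rewrite (h Sk); exact: add_mul0mx.
- exists m, 1%N, (fun=> 0), A, B, (fun=> 0), (fun=> 0), (fun=> 0).
  split; [by rewrite m0|split; [exact (c0 _ _)|exact cA|exact cB|exact (c0 _ _)..]|exact k0|].
  move=> u; have av := L2_map_avg1; have mB := L2_map_mul cB.
  have h := acts_as_comp av mB avg1_op_acts (mul_op_acts cB).
  apply: ae_square_trans (mul_acts_comp cA (L2_map_comp av mB) h u) _.
  apply: filterS (a0 u) => k h0 Sk; rewrite (h0 Sk); exact: mul0mx_add1.
- exists 1%N, m, (fun=> 0), (fun=> 0), (fun=> 0), A, B, (fun=> 0).
  split; [by rewrite m0|split; [exact (c0 _ _)..|exact cA|exact cB]|exact k0|].
  move=> u; have av := @L2_map_avg2 R m; have mB := L2_map_mul cB.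
  have h := acts_as_comp av mB (@avg2_op_acts R m) (mul_op_acts cB).
  apply: ae_square_trans (mul_acts_comp cA (L2_map_comp av mB) h u) _.
  apply: filterS (a0 u) => k h0 Sk; rewrite (h0 Sk); exact: mul0mx_add2.
- exists 1%N, 1%N, (fun=> 0), (fun=> 0), (fun=> 0), (fun=> 0), (fun=> 0), K.
  split; [by []|split; exact (c0 _ _)|exact cK|].
  by move=> u; apply/aeW => k _; exact: mul0mx_add3.
Qed.

Lemma elementary_sum_defect_form T : (0 < m)%N -> elementary_sum T -> defect_form T.
Proof.
move=> m0; elim=> [|T' eT'|T1 T2 _ f1 _ f2]; last exact: defect_formD.
- apply: (elementary_op_defect_form m0); apply: elementary_compact.
  exact: compact_op0.
- exact: elementary_op_defect_form.
Qed.

Lemma elementary_sum_sum n (T : 'I_n -> E -> E) :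
  (forall j, elementary_sum (T j)) -> elementary_sum (fun u => \sum_(j < n) T j u).
Proof.
move=> h; elim: (index_enum _) => [|j s IHs].
  by under eq_fun do rewrite big_nil; exact: elementary_sum0.
by under eq_fun do rewrite big_cons; exact: elementary_sumD.
Qed.

(** The coordinate i0 receives the j-th row of B and feeds the j-th column of A;
    it exists because m is positive. *)
Lemma defect_form_elementary T : (0 < m)%N -> defect_form T -> elementary_sum T.
Proof.
move=> m0 [M1 [M2 [A0 [A1 [B1 [A2 [B2 [K [_ [c0 c1 d1 c2 d2] cK a]]]]]]]]].
pose i0 := Ordinal m0.
pose X1 j k : 'M[R[i]]_m := A1 k *m delta_mx j i0.
pose Y1 j k : 'M[R[i]]_m := delta_mx i0 j *m B1 k.
pose X2 j k : 'M[R[i]]_m := A2 k *m delta_mx j i0.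
pose Y2 j k : 'M[R[i]]_m := delta_mx i0 j *m B2 k.
have cX1 j : continuous_mx (X1 j) := continuous_mxM c1 (@continuous_mx_cst _ _ _ _).
have cY1 j : continuous_mx (Y1 j) := continuous_mxM (@continuous_mx_cst _ _ _ _) d1.
have cX2 j : continuous_mx (X2 j) := continuous_mxM c2 (@continuous_mx_cst _ _ _ _).
have cY2 j : continuous_mx (Y2 j) := continuous_mxM (@continuous_mx_cst _ _ _ _) d2.
have -> : T = (fun u => mul_op A0 u +
    \sum_(j < M1) (mul_op (X1 j) \o avg1_op \o mul_op (Y1 j)) u +
    \sum_(j < M2) (mul_op (X2 j) \o @avg2_op R m \o mul_op (Y2 j)) u + K u).
  apply: (acts_as_unique a).
  have aK : acts_as K (fun u => L2_fun (K u)) by move=> u; exact: ae_eq_refl.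
  have a1 j : acts_as (mul_op (X1 j) \o avg1_op \o mul_op (Y1 j))
      (mulmap (X1 j) \o (@avg1 R m \o mulmap (Y1 j))).
    have av := L2_map_avg1; have aav := avg1_op_acts.
    have h := acts_as_comp av (L2_map_mul (cY1 j)) aav (mul_op_acts (cY1 j)).
    exact: (mul_acts_comp (cX1 j) (L2_map_comp av (L2_map_mul (cY1 j))) h).
  have a2 j : acts_as (mul_op (X2 j) \o @avg2_op R m \o mul_op (Y2 j))
      (mulmap (X2 j) \o (@avg2 R m \o mulmap (Y2 j))).
    have av := @L2_map_avg2 R m; have aav := @avg2_op_acts R m.
    have h := acts_as_comp av (L2_map_mul (cY2 j)) aav (mul_op_acts (cY2 j)).
    exact: (mul_acts_comp (cX2 j) (L2_map_comp av (L2_map_mul (cY2 j))) h).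
  have h := acts_asD (acts_asD (acts_asD (mul_op_acts c0) (acts_as_sum a1))
    (acts_as_sum a2)) aK.
  move=> u; apply: ae_square_trans (h u) _; apply/aeW => k _.
  congr (_ + _ + _ + _).
  - rewrite -(sum_delta_sandwich i0); apply: eq_bigr => j _.
    rewrite /mulmap/= -(avg1_delta i0 j (fun k' => B1 k' *m L2_fun u k')).
    congr (_ *m avg1 _ _).
    by apply/funext => k'; rewrite mulmxA.
  - rewrite -(sum_delta_sandwich i0); apply: eq_bigr => j _.
    rewrite /mulmap/= -(avg2_delta i0 j (fun k' => B2 k' *m L2_fun u k')).
    congr (_ *m avg2 _ _).
    by apply/funext => k'; rewrite mulmxA.
have s1 := elementary_sum_sum
  (fun j => elementary_sum1 (elementary_avg1 (cX1 j) (cY1 j))).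
have s2 := elementary_sum_sum
  (fun j => elementary_sum1 (elementary_avg2 (cX2 j) (cY2 j))).
have s0 := elementary_sum1 (elementary_mul c0).
have sK := elementary_sum1 (elementary_compact cK).
exact (elementary_sumD (elementary_sumD (elementary_sumD s0 s1) s2) sK).
Qed.
End DefectAlgebra.

Theorem theorem1p2 (R : realType) (M : nat) (hM : (0 < M)%N) :
  (forall T : L2 R M -> L2 R M, @defect_algebra R M T -> @defect_form R M T) /\
  [set T : L2 R M -> L2 R M | @defect_form R M T] = @defect_algebra R M.
Proof.
have sub : forall T : L2 R M -> L2 R M, defect_algebra T -> defect_form T.
  by move=> T /defect_algebra_elementary; exact: elementary_sum_defect_form.
split => //; apply/seteqP; split=> T; last exact: sub.
by move=> /(defect_form_elementary hM); exact: elementary_defect_algebra.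
Qed.
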